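(* Let $S_t=\sum_{-r<s\le t}(\Delta L_s)^2$ and $S^n_t=\sum_{-r<s\le t}(\Delta L_s)^2\mathbf 1_{\{|\Delta L_s|\ge1/n\}}$, $n\in\mathbb N$. Let $X$ be the unique solution of $dX_t=b(X)_t\,dt+c_\nu X_{t-}\,dS_t$ and $X^n$ the unique solution of $dX^n_t=b^n(X^n)_t\,dt+c_\nu X^n_{t-}\,dS^n_t$, both with initial condition $\Phi$ on $[-r,0]$, where $b(H)_t=\eta-c_\mu H_t+\int_{t-p}^tf_\mu(u-t)H_u\,du+\int_{t-q+}^tf_\nu(u-t)H_{u-}\,dS_u$ and $b^n$ is defined identically with $S^n$ in place of $S$. Then $X^n\to X$ uniformly on compacts in probability as $n\to\infty$.
   Context: Let $p,q\ge0$, $r:=p\vee q$, $(\Omega,\mathcal F,\mathbb F=(\mathcal F_t)_{t\ge-r},\mathbb P)$ a filtered probability space with the usual conditions, and $(L_t)_{t\ge-r}$ a càdlàg adapted centered Lévy process with $L_{-r}=0$, increments independent of the past and stationary, no Brownian component, and $\mathbb E[L_1^4]<\infty$. Parameters: $\eta>0$, $c_\mu,c_\nu>0$, $f_\mu,f_\nu$ nonnegative continuous supported on $[-p,0]$, $[-q,0]$. $\Phi$ is a càdlàg process on $[-r,0]$ adapted to the natural filtration of $L$ with $\mathbb E[\sup_{[-r,0]}|\Phi|^2]<\infty$. Solutions are understood as the unique adapted càdlàg processes $X$ on $[-r,\infty)$ with $\mathbb E[\sup_{s\in[-r,t]}|X_s|^2]<\infty$ for all $t$. Convergence uniformly on compacts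 in probability means $\sup_{s\le t}|X^n_s-X_s|\to0$ in probability for every $t>0$. *)

(* Defs.v *)
From HB Require Import structures.
From mathcomp Require Import all_boot all_order all_algebra.
From mathcomp Require Import all_classical all_reals all_analysis.
Set Implicit Arguments. Unset Strict Implicit. Unset Printing Implicit Defensive.
Import Order.TTheory GRing.Theory Num.Theory numFieldNormedType.Exports.
Local Open Scope classical_set_scope.
Local Open Scope ring_scope.

Section Defs.
Context {d : measure_display} {T : measurableType d} {R : realType}.
Variable P : probability T R.

Definition leftlim (f : R -> R) (t : R) : R := lim (f x @[x --> t^'-]).

Definition jump (f : R -> R) (t : R) : R := f t - leftlim f t.

Definition cadlag_on (a : R) (b : \bar R) (f : R -> R) : Prop :=
  (forall t, a <= t -> (t%:E < b)%E -> f x @[x --> t^'+] --> f t) /\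
  (forall t, a < t -> (t%:E <= b)%E -> cvg (f x @[x --> t^'-])).

Definition ssum (A : set R) (g : R -> R) : R :=
  fine ((\esum_(s in A) (Num.max (g s) 0)%:E) -
        (\esum_(s in A) (Num.max (- g s) 0)%:E))%E.

(* Pathwise Stieltjes integral against the pure-jump increasing process
     S^kappa_t = sum_{-r < s <= t} (Delta l_s)^2 1_{|Delta l_s| >= kappa}
   over the interval (a, b]:
     int_(a,b] h(u) dS^kappa_u = sum_{a < u <= b} h(u) (Delta l_u)^2 1_{|Delta l_u|>=kappa}.
   kappa = 0 gives S, kappa = 1/n gives S^n. *)
Definition dS (kappa : R) (l : R -> R) (a b : R) (h : R -> R) : R :=
  ssum `]a, b] (fun u => if kappa <= `|jump l u| then h u * (jump l u) ^+ 2
                         else 0).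

Definition drift (eta c_mu p q : R) (f_mu f_nu : R -> R) (kappa : R)
  (l H : R -> R) (t : R) : R :=
  eta - c_mu * H t
  + (\int[lebesgue_measure]_(u in `[t - p, t]) (f_mu (u - t) * H u))
  + dS kappa l (t - q) t (fun u => f_nu (u - t) * leftlim H u).

Definition G_measurable (G : set (set T)) (f : T -> R) : Prop :=
  forall B : set R, measurable B -> f @^-1` B \in G.

Definition usual_filtration (r : R) (F : R -> set (set T)) : Prop :=
  (forall t, -r <= t -> sigma_algebra setT (F t)) /\
  (forall t, -r <= t -> F t `<=` measurable) /\
  (forall s t, -r <= s -> s <= t -> F s `<=` F t) /\
  (forall t, -r <= t -> \bigcap_(u in `]t, +oo[) F u `<=` F t) /\
  (forall N A, measurable A -> P A = 0%E -> N `<=` A -> F (-r) N).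

Definition adapted (r : R) (F : R -> set (set T)) (X : R -> T -> R) :=
  forall t, -r <= t -> G_measurable (F t) (X t).

Definition natural_sigma (r : R) (L : R -> T -> R) (t : R) : set (set T) :=
  <<s [set (L u) @^-1` B | u in `[-r, t] & B in @measurable _ R]>>.

Definition sup_sq_integrable (X : R -> T -> R) (a b : R) : Prop :=
  (\int[P]_w ereal_sup [set (`|X s w| ^+ 2)%:E | s in `[a, b]] < +oo)%E.

Definition incr (L : R -> T -> R) (s t : R) : T -> R := fun w => L t w - L s w.

Definition sup_abs_diff (X Y : R -> T -> R) (a b : R) (w : T) : \bar R :=
  ereal_sup [set (`|X s w - Y s w|)%:E | s in `[a, b]].

Definition Levy_no_brownian (r : R) (F : R -> set (set T)) (L : R -> T -> R)
  : Prop :=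
  adapted r F L /\
  (forall w, cadlag_on (-r) +oo%E (fun t => L t w)) /\
  (forall w, L (-r) w = 0) /\
  (forall s t, -r <= s -> s <= t -> forall A B, F s A -> measurable B ->
     P (A `&` (incr L s t) @^-1` B) =
     (P A * P ((incr L s t) @^-1` B))%E) /\
  (forall s t s' t', -r <= s -> s <= t -> -r <= s' -> s' <= t' ->
     t - s = t' - s' -> forall B, measurable B ->
     P ((incr L s t) @^-1` B) =
     P ((incr L s' t') @^-1` B)) /\
  (forall t, -r <= t -> P.-integrable setT (fun w => (L t w)%:E) /\
     (\int[P]_w (L t w)%:E = 0)%E) /\
  (\int[P]_w ((L 1 w) ^+ 4)%:E < +oo)%E /\
  (* no Brownian component: Levy-Khintchine with Gaussian part 0, i.e.
     E[exp(i u (L_t - L_s))] = exp((t-s) (i u gamma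
         + int (e^{iux} - 1 - i u x 1_{|x|<1}) nu(dx))),
     written out in real and imaginary parts. *)
  (exists (gamma : R) (nu : {measure set R -> \bar R}),
     nu [set 0] = 0%E /\
     (\int[nu]_x (Num.min 1 (x ^+ 2))%:E < +oo)%E /\
     forall s t u, -r <= s -> s <= t ->
       let re := \int[nu]_x (cos (u * x) - 1) in
       let im := u * gamma +
                 \int[nu]_x (sin (u * x) - (if `|x| < 1 then u * x else 0)) in
       \int[P]_w cos (u * (L t w - L s w)) = expR ((t - s) * re) * cos ((t - s) * im) /\
       \int[P]_w sin (u * (L t w - L s w)) = expR ((t - s) * re) * sin ((t - s) * im)).

Definition is_solution (r eta c_mu c_nu p q : R) (f_mu f_nu : R -> R)
  (kappa : R) (F : R -> set (set T)) (L Phi X : R -> T -> R) : Prop :=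
  adapted r F X /\
  (forall w, cadlag_on (-r) +oo%E (fun t => X t w)) /\
  (forall t, 0 <= t -> sup_sq_integrable X (-r) t) /\
  (forall t w, -r <= t <= 0 -> X t w = Phi t w) /\
  (forall t, 0 <= t -> measurable_fun setT (X t)) /\
  (\forall w \ae P, forall t, 0 <= t ->
     X t w = X 0 w
       + (\int[lebesgue_measure]_(s in `[0, t])
            drift eta c_mu p q f_mu f_nu kappa (fun u => L u w) (fun u => X u w) s)
       + c_nu * dS kappa (fun u => L u w) 0 t (fun u => leftlim (fun v => X v w) u)).

End Defs.

(* Main.v *)
Require Import Defs.
From HB Require Import structures.
From mathcomp Require Import all_boot all_order all_algebra.
From mathcomp Require Import all_classical all_reals all_analysis.
From mathcomp Require Import measurable_realfun.
From mathcomp Require Import finmap ring lra.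
Set Implicit Arguments.
Unset Strict Implicit.
Import Order.TTheory GRing.Theory Num.Theory numFieldNormedType.Exports.
Local Open Scope classical_set_scope.
Local Open Scope ring_scope.

(** Proof idea.  The equations have no stochastic integral in the proper sense:
    [S] is increasing, so on the event where [S] is finite on compacts both
    equations can be read path by path.  Along such a path, [z = X^n - X] solves
    the same linear equation up to an error controlled by the mass
    [rho_n = sum (Delta L)^2 1_{|Delta L| < 1/n}] of the discarded jumps, and a
    Gronwall argument with the weight [e^{lam t + c S_t}] gives
    [sup |z| <= C rho_n] with [C] depending on the path but not on [n].  Since
    [rho_n] is the tail of a convergent sum, [X^n -> X] almost surely, uniformly
    on compacts, hence in probability.

    That [S] is almost surely finite is seen from the dyadic quadratic variation:
    two consecutive increments of equal length are independent, centered and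
    equally distributed, so halving the mesh does not increase the mean of the sum
    of squared increments.  By Fatou its lower limit, which dominates the sum of
    the squared jumps, is integrable. *)

(** * Regularity of càdlàg paths: measurability, local boundedness, left limits *)

Section Cadlag.
Context {R : realType}.
Implicit Types (f g : R -> R).

(** [u n x] is the first point of the grid of mesh [1 / (n + 1)] strictly to the right of [x]. Right
    continuity makes [f] the pointwise limit of the functions [f (u n x)], which are constant on
    each cell of the grid and hence measurable. *)
Lemma right_continuous_measurable f :
  (forall x, f y @[y --> x^'+] --> f x) -> measurable_fun setT f.
Proof.
move=> rf.
pose u (n : nat) (x : R) : R := (Num.floor (x * n.+1%:R) + 1)%:~R / n.+1%:R.
have n0 n : 0 < n.+1%:R :> R by [].
apply: (@measurable_fun_cvg _ _ _ setT (fun n x => f (u n x))).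
- move=> n _ Y mY; rewrite setTI.
  rewrite (_ : _ @^-1` Y = \bigcup_(k in [set: int])
      [set x | (f ((k + 1)%:~R / n.+1%:R) \in Y) &&
               (x \in `[k%:~R / n.+1%:R, (k + 1)%:~R / n.+1%:R[)]); last first.
    apply/seteqP; split=> x /=.
      move=> Yx; exists (Num.floor (x * n.+1%:R)) => //=.
      rewrite mem_set //= in_itv /= ler_pdivrMr // ltr_pdivlMr //.
      exact: floor_itv.
    move=> [k _ /= /andP[/set_mem Yk]]; rewrite in_itv /=.
    by rewrite ler_pdivrMr // ltr_pdivlMr // /u => /floor_def ->.
  apply: countable_bigcupT_measurable => // k.
  have [Yk|Yk] := boolP (f ((k + 1)%:~R / n.+1%:R) \in Y).
    exact: measurable_itv.
  rewrite (_ : [set _ | _] = set0) //.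
  by apply/seteqP; split=> // x /=.
- move=> x _; apply: (proj1 (cvg_at_rightP f x (f x)) (rf x) (u ^~ x)).
  have xu n : x < u n x by rewrite /u ltr_pdivlMr // floorD1_gt.
  split=> //.
  apply: (@squeeze_cvgr _ _ _ _ (fun=> x) (fun n => x + n.+1%:R^-1)).
  + near=> n; rewrite ltW //= /u ler_pdivrMr // mulrDl mulVf ?gt_eqF //.
    by rewrite intrD lerD2r floor_le.
  + exact: cvg_cst.
  + rewrite -[X in _ --> X]addr0; apply: cvgD; first exact: cvg_cst.
    exact: cvg_harmonic.
Unshelve. all: by end_near. Qed.

Lemma right_continuous_measurable_itv f a b :
  (forall x, a <= x -> f y @[y --> x^'+] --> f x) -> measurable_fun `[a, b] f.
Proof.
move=> rf.
(* Freezing the argument at [a] gives a function that is right continuous on the whole line. *)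
apply: (@eq_measurable_fun _ _ R R `[a, b]%classic (fun x => f (Num.max x a))).
  by move=> x /set_mem /=; rewrite in_itv /= => /andP[ax _]; rewrite max_l.
apply: measurable_funTS; apply: right_continuous_measurable => x.
have [ax|xa] := leP a x.
  apply: cvg_trans (rf _ ax); apply: near_eq_cvg; near=> y.
  by rewrite max_l // (le_trans ax) // ltW //; near: y; exact: nbhs_right_gt.
apply: cvg_near_cst; near=> y.
have ya : y < a by near: y; exact: nbhs_right_lt.
by rewrite max_r // ltW.
Unshelve. all: by end_near. Qed.

(** Near each point the one-sided limits bound [f] on either side and the value at the point is
    added; compactness of [[a, b]] yields a single bound. To the left of [a] nothing is known, hence
    the guard [a <= x] in the covered property. *)
Lemma cadlag_bounded f a b : cadlag_on a +oo%E f ->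
  exists M, 0 <= M /\ forall t, a <= t <= b -> `|f t| <= M.
Proof.
move=> [rf lf].
have /compact_near_coveringP := @segment_compact R a b.
move=> /(_ R (+oo)%R (fun M x => a <= x -> `|f x| <= M) _) [].
  move=> x /=; rewrite in_itv /= => /andP[ax xb].
  have Hr : \forall y \near x^'+ & M \near +oo, a <= y -> `|f y| <= M.
    have /cvgrPdist_le/(_ 1 ltr01) h := rf x ax (ltry _).
    near=> y M => ay.
    have h1 : `|f x - f y| <= 1 by near: y; exact: h.
    have h2 : `|f x| + 1 <= M.
      by near: M; apply: nbhs_pinfty_ge; rewrite num_real.
    by have := ler_normB (f x) (f x - f y); rewrite subKr /= => /le_trans; apply; lra.
  have Hl : \forall y \near x^'- & M \near +oo, a <= y -> `|f y| <= M.
    move: ax; rewrite le_eqVlt => /orP[/eqP <-|ax].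
      near=> y M => /= ay; have : y < a by near: y; exact: nbhs_left_lt.
      by rewrite ltNge ay.
    have /cvg_ex[l /cvgrPdist_le/(_ 1 ltr01) h] := lf x ax (leey _).
    near=> y M => ay.
    have h1 : `|l - f y| <= 1 by near: y; exact: h.
    have h2 : `|l| + 1 <= M.
      by near: M; apply: nbhs_pinfty_ge; rewrite num_real.
    by have := ler_normB l (l - f y); rewrite subKr /= => /le_trans; apply; lra.
  have Hx : \forall M \near +oo, `|f x| <= M.
    by apply: nbhs_pinfty_ge; rewrite num_real.
  move: Hr Hl => [[A1 B1] /= [A1x B1o] H1] [[A2 B2] /= [A2x B2o] H2].
  exists ((fun y => A1 y \/ A2 y \/ y = x), B1 `&` B2 `&` [set M | `|f x| <= M]).
    split => /=.
      rewrite /at_right /at_left /within in A1x A2x.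
      near=> y; have [yx|yx|->] := ltgtP y x; last by right; right.
        right; left; have : y < x by []. by near: y; exact: A2x.
      left; have : x < y by []. by near: y; exact: A1x.
    by apply: filterI => //; apply: filterI.
  move=> [y M] /= [[A1y|[A2y|->]] [[b1 b2] b3]] ay //.
  + exact: (H1 (y, M)).
  + exact: (H2 (y, M)).
move=> M0 [_ HM]; exists (Num.max (M0 + 1) 0).
split; first by rewrite le_max lexx orbT.
move=> t /andP[at_ tb]; rewrite le_max; apply/orP; left.
by apply: (HM (M0 + 1)) => //; [rewrite ltrDl|rewrite /= in_itv /= at_ tb].
Unshelve. all: by end_near. Qed.

Lemma leftlim_norm_le f a t B : a < t -> cvg (f x @[x --> t^'-]) ->
  (forall s, a <= s -> s < t -> `|f s| <= B) -> `|leftlim f t| <= B.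
Proof.
move=> at_ cf fB; apply/ler_addgt0Pr => e e0; rewrite /leftlim.
have /cvgrPdist_le/(_ e e0) h : f x @[x --> t^'-] --> lim (f x @[x --> t^'-]).
  by [].
near t^'- => s.
have h1 : `|lim (f x @[x --> t^'-]) - f s| <= e by near: s; exact: h.
have h2 : `|f s| <= B.
  apply: fB; first by near: s; exact: nbhs_left_ge.
  by near: s; exact: nbhs_left_lt.
by have := ler_normD (lim (f x @[x --> t^'-]) - f s) (f s); rewrite subrK; lra.
Unshelve. all: by end_near. Qed.

Lemma leftlimB f g t : cvg (f x @[x --> t^'-]) -> cvg (g x @[x --> t^'-]) ->
  leftlim (fun x => f x - g x) t = leftlim f t - leftlim g t.
Proof. by move=> cf cg; apply/cvg_lim => //; exact: cvgB. Qed.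

End Cadlag.

(** * Unordered sums over sets of times and a telescoping bound *)

Section Sums.
Context {R : realType}.
Implicit Types (f g j : R -> R) (A B : set R).

Lemma esum_supp A B (f : R -> \bar R) : A `<=` B ->
  (forall u, B u -> ~ A u -> f u = 0%E) ->
  (\esum_(u in A) f u = \esum_(u in B) f u)%E.
Proof.
move=> AB f0; rewrite [LHS]esum_mkcond [RHS]esum_mkcond; apply: eq_esum => u _.
have [/set_mem uA|/negP uA] := boolP (u \in A); first by rewrite mem_set //; exact: AB.
have [/set_mem uB|//] := boolP (u \in B); rewrite f0 // => Au.
by apply: uA; rewrite mem_set.
Qed.

Lemma subset_esum A B f : A `<=` B -> (forall u, 0 <= f u) ->
  (\esum_(u in A) (f u)%:E <= \esum_(u in B) (f u)%:E)%E.
Proof.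
move=> AB f0; rewrite [leLHS]esum_mkcond [leRHS]esum_mkcond.
apply: le_esum => u _.
have [/set_mem uA|//] := boolP (u \in A); first by rewrite mem_set //; exact: AB.
by case: ifP => _; rewrite ?lee_fin.
Qed.

(** The finite subsets that define the sum are listed in increasing order, as a telescoping argument
    along time requires. *)
Lemma esum_le_sorted A f b :
  (forall s : seq R, sorted <%R s -> (forall u, u \in s -> A u) ->
    \sum_(u <- s) f u <= b) ->
  (\esum_(u in A) (f u)%:E <= b%:E)%E.
Proof.
move=> fb; apply: ge_ereal_sup => _ [X [finX XA] <-].
rewrite fsbig_finite //= sumEFin lee_fin.
have pX : perm_eq (sort <=%R (enum_fset (fset_set X))) (enum_fset (fset_set X)) by rewrite perm_sort.
rewrite -(perm_big _ pX) /=; apply: fb.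
  by rewrite lt_sorted_uniq_le sort_uniq sort_sorted ?fset_uniq //; exact: le_total.
by move=> u; rewrite mem_sort in_fset_set // => /set_mem /XA.
Qed.

Lemma esumZ_le A f c b : 0 <= c -> (forall u, 0 <= f u) ->
  (\esum_(u in A) (f u)%:E <= b%:E)%E ->
  (\esum_(u in A) (c * f u)%:E <= (c * b)%:E)%E.
Proof.
move=> c0 f0 fb; apply: ge_ereal_sup => _ [X XA <-].
rewrite fsbig_finite ?sumEFin ?lee_fin; last by case: XA.
rewrite -mulr_sumr ler_wpM2l // -lee_fin -sumEFin -fsbig_finite; last by case: XA.
by apply: le_trans fb; apply: ereal_sup_ubound; exists X.
Qed.

(** [ssum] takes [fine] of a difference of extended sums; absolute summability keeps all four parts
    finite. The estimate sums [h^+ + k^- <= h^- + k^+ + |h - k|], once in each order. *)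
Lemma ssum_dist_le A f g b : 
  (\esum_(u in A) (`|f u|)%:E < +oo)%E -> (\esum_(u in A) (`|g u|)%:E < +oo)%E ->
  (\esum_(u in A) (`|f u - g u|)%:E <= b%:E)%E ->
  `|ssum A f - ssum A g| <= b.
Proof.
move=> fy gy fgb.
have fin (h : R -> R) : (\esum_(u in A) (`|h u|)%:E < +oo)%E ->
    (\esum_(s in A) (Num.max (h s) 0)%:E)%E \is a fin_num /\
    (\esum_(s in A) (Num.max (- h s) 0)%:E)%E \is a fin_num.
  have maxfin (k : R -> R) : (forall u, Num.max (k u) 0 <= `|h u|) ->
      (\esum_(u in A) (`|h u|)%:E < +oo)%E ->
      (\esum_(s in A) (Num.max (k s) 0)%:E)%E \is a fin_num.
    move=> kh hy; rewrite ge0_fin_numE.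
      by apply: le_lt_trans hy; apply: le_esum => u _; rewrite lee_fin.
    by apply: esum_ge0 => u _; rewrite lee_fin le_max lexx orbT.
  move=> hy; split; apply: maxfin => // u; rewrite ge_max normr_ge0 andbT.
    exact: ler_norm.
  by rewrite -normrN ler_norm.
have [f1 f2] := fin f fy; have [g1 g2] := fin g gy.
have key (h k : R -> R) : 
    (\esum_(u in A) (`|h u - k u|)%:E <= b%:E)%E ->
    (\esum_(s in A) (Num.max (h s) 0)%:E + \esum_(s in A) (Num.max (- k s) 0)%:E
     <= \esum_(s in A) (Num.max (- h s) 0)%:E + 
        \esum_(s in A) (Num.max (k s) 0)%:E + b%:E)%E.
  move=> hkb; apply: le_trans (leeD2l _ hkb).
  rewrite -!esumD; try by move=> u _; rewrite -?EFinD lee_fin ?addr_ge0 // le_max lexx orbT.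
  apply: le_esum => u _; rewrite -!EFinD lee_fin.
  have := ler_norm (h u - k u).
  by case: (leP (h u) 0); case: (leP (k u) 0); case: (leP (- h u) 0);
     case: (leP (- k u) 0); lra.
have := key f g fgb.
have := key g f; rewrite (@eq_esum _ _ _ _ (fun u => (`|f u - g u|)%:E)); last first.
  by move=> u _; rewrite distrC.
move=> /(_ fgb).
rewrite /ssum -(fineK f1) -(fineK f2) -(fineK g1) -(fineK g2).
by rewrite -!EFinD !lee_fin /= => h1 h2; rewrite ler_norml; lra.
Qed.

Lemma ssum_supp A B f : A `<=` B ->
  (forall u, B u -> ~ A u -> f u = 0) -> ssum A f = ssum B f.
Proof.
move=> AB f0; congr (fine (_ - _)%E); apply: esum_supp => // u Bu Au;
  by rewrite f0 ?oppr0 ?maxxx.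
Qed.

(* Telescoping, from [c x <= e^{c x} - 1]. *)
Lemma sum_expR_sorted_le (c a : R) (j m : R -> R) : 0 < c ->
  (forall u v, a < u -> u < v -> m u + j u <= m v) ->
  forall (s : seq R) b, sorted <%R s ->
    (forall u, u \in s -> a < u /\ m u + j u <= b) ->
    \sum_(u <- s) expR (c * m u) * j u <= expR (c * b) / c.
Proof.
move=> c0 mj; elim/last_ind => [|s x IH] b.
  by move=> _ _; rewrite big_nil divr_ge0 ?expR_ge0 // ltW.
move=> ss sb; rewrite -cats1 big_cat big_seq1 /=.
have [ax xb] := sb x ltac:(by rewrite mem_rcons in_cons eqxx).
have srt : sorted <%R s by move: ss; rewrite -cats1 => /cat_sorted2[].
have h1 : \sum_(u <- s) expR (c * m u) * j u <= expR (c * m x) / c.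
  apply: IH => // u us; have [au _] := sb u ltac:(by rewrite mem_rcons in_cons us orbT).
  split=> //; apply: mj => //.
  by move: ss; rewrite (sorted_pairwise lt_trans) pairwise_rcons => /andP[/allP /(_ u us)].
apply: le_trans (lerD h1 (lexx _)) _.
rewrite ler_pdivlMr // mulrDl mulfVK ?gt_eqF //.
apply: (@le_trans _ _ (expR (c * m x) * expR (c * j x))).
  by have := expR_ge1Dx (c * j x); have := expR_gt0 (c * m x); nra.
by rewrite -expRD ler_expR; nra.
Qed.

End Sums.

(** * Delay kernels and the drift along a single path *)

Section Kernels.
Context {R : realType}.
Implicit Types (f H l : R -> R).
Local Notation mu := (@lebesgue_measure R).

(** Continuity in the shift, made uniform in [u] by compactness; both delay terms owe their right
    continuity in time to it. *)
Lemma near_translate_le f (a b s e : R) : continuous f -> 0 < e ->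
  \forall s' \near s, forall u, a <= u <= b -> `|f (u - s) - f (u - s')| <= e.
Proof.
move=> cf e0.
have /compact_near_coveringP := @segment_compact R a b.
move=> /(_ R (nbhs s) (fun s' u => `|f (u - s) - f (u - s')| <= e) _) [].
  move=> u _; have e20 : 0 < e / 2 by rewrite divr_gt0.
  have := cf (u - s) => /cvgrPdist_le /(_ _ e20) /nbhs_ballP[d /= d0 hd].
  have d20 : 0 < d / 2 by rewrite divr_gt0.
  exists (ball u (d / 2), ball s (d / 2)) => /=; first by split; apply: nbhsx_ballx.
  move=> [u' s'] /=; rewrite /ball /= => -[hu hs].
  have h1 : `|f (u - s) - f (u' - s)| <= e / 2.
    apply: hd; rewrite /ball /=.
    by rewrite (_ : u - s - (u' - s) = u - u'); [lra|ring].
  have h2 : `|f (u - s) - f (u' - s')| <= e / 2.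
    apply: hd; rewrite /ball /=.
    rewrite (_ : u - s - (u' - s') = (u - u') - (s - s')); last by ring.
    by have := ler_normB (u - u') (s - s'); lra.
  rewrite (_ : f (u' - s) - f (u' - s') =
     (f (u - s) - f (u' - s')) - (f (u - s) - f (u' - s))); last by ring.
  by have := ler_normB (f (u - s) - f (u' - s')) (f (u - s) - f (u' - s)); lra.
by move=> d /= d0 hd; exists d.
Qed.

Lemma compact_support_bounded f c : continuous f ->
  (forall x, ~ (- c <= x <= 0) -> f x = 0) ->
  exists K, 0 <= K /\ forall x, `|f x| <= K.
Proof.
move=> cf f0.
have [|K [K0 fK]] := @cadlag_bounded R f (- c) 0.
  split=> t _ _; first by apply: cvg_at_right_filter; exact: cf.
  by apply/cvg_ex; exists (f t); apply: cvg_at_left_filter; exact: cf.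
exists K; split=> // x; have [cx|/negP cx] := boolP (- c <= x <= 0); first exact: fK.
by rewrite f0 // normr0.
Qed.

(** The jump sum in the drift runs over []s - c, s]] and leaves out the point [s - c] of the closed
    support. The kernel vanishes there, so the window can be enlarged without changing the sum. *)
Lemma continuous_support_boundary f c : continuous f ->
  (forall x, ~ (- c <= x <= 0) -> f x = 0) -> f (- c) = 0.
Proof.
move=> cf f0.
have h : f x @[x --> (- c)^'-] --> f (- c) by apply: cvg_at_left_filter; exact: cf.
have h0 : f x @[x --> (- c)^'-] --> (0 : R).
  apply: cvg_near_cst; near=> x; apply: f0.
  have : x < - c by near: x; exact: nbhs_left_lt.
  by lra.
exact: (cvg_unique _ h h0).
Unshelve. all: by end_near. Qed.

Lemma right_continuous_integrable f a b M :
  (forall x, a <= x -> f y @[y --> x^'+] --> f x) ->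
  (forall x, a <= x <= b -> `|f x| <= M) ->
  mu.-integrable `[a, b] (EFin \o f).
Proof.
move=> rf fM; apply: measurable_bounded_integrable => //.
- by rewrite /= lebesgue_measure_itv /=; case: ifP => _ //; rewrite -EFinB ltry.
- exact: right_continuous_measurable_itv.
- exists M; split; first by rewrite num_real.
  by move=> N MN x /=; rewrite in_itv /= => xab; apply: le_trans (ltW MN); exact: fM.
Qed.

Lemma normr_Rintegral_itv_le f a b M : a <= b ->
  mu.-integrable `[a, b] (EFin \o f) ->
  (forall x, a <= x <= b -> `|f x| <= M) ->
  `|\int[mu]_(x in `[a, b]) f x| <= M * (b - a).
Proof.
move=> ab fi fM; apply: le_trans (le_normr_Rintegral _ fi) _ => //.
have muab : mu `[a, b] = (b - a)%:E.
  rewrite lebesgue_measure_itv /= lte_fin; case: ltP => // ba.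
  by have -> : b = a by [apply/eqP; rewrite eq_le ba]; rewrite subrr.
have <- : \int[mu]_(x in `[a, b]) (cst M x) = M * (b - a).
  by rewrite Rintegral_cst //= muab.
apply: le_Rintegral => //.
- by move/integrable_abse : fi.
- apply: measurable_bounded_integrable => //; first by rewrite /= muab ltry.
  exists `|M|; split; first by rewrite num_real.
  by move=> N MN x /= _; exact: ltW.
Qed.

Lemma Rintegral_supp (A B : set R) f : A `<=` B ->
  (forall u, B u -> ~ A u -> f u = 0) ->
  \int[mu]_(u in A) f u = \int[mu]_(u in B) f u.
Proof.
move=> AB f0; rewrite Rintegral_mkcond [RHS]Rintegral_mkcond; congr (Rintegral _ _ _).
apply/funext => u; rewrite /patch.
have [/set_mem uA|/negP uA] := boolP (u \in A); first by rewrite mem_set //; exact: AB.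
have [/set_mem uB|//] := boolP (u \in B); rewrite f0 // => Au.
by apply: uA; rewrite mem_set.
Qed.

Lemma esum_normr_le (A : set R) (h j : R -> R) c b : 0 <= c ->
  (forall u, 0 <= j u) -> (forall u, A u -> `|h u| <= c * j u) ->
  (\esum_(u in A) (j u)%:E <= b%:E)%E ->
  (\esum_(u in A) (`|h u|)%:E <= (c * b)%:E)%E.
Proof.
move=> c0 j0 hj jb; apply: le_trans (esumZ_le c0 j0 jb).
by apply: le_esum => u Au; rewrite lee_fin; exact: hj.
Qed.

(* The mass at [u] of the measure that [dS kappa l] integrates against. *)
Definition bigjump kappa l u := if kappa <= `|jump l u| then (jump l u) ^+ 2 else 0.

Lemma bigjump_ge0 kappa l u : 0 <= bigjump kappa l u.
Proof. by rewrite /bigjump; case: ifP => // _; exact: sqr_ge0. Qed.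

Lemma bigjump_le kappa l u : bigjump kappa l u <= (jump l u) ^+ 2.
Proof. by rewrite /bigjump; case: ifP => // _; exact: sqr_ge0. Qed.

Lemma dSE kappa l a b h :
  dS kappa l a b h = ssum `]a, b] (fun u => h u * bigjump kappa l u).
Proof.
rewrite /dS; congr ssum; apply/funext => u.
by rewrite /bigjump; case: ifP; rewrite ?mulr0.
Qed.

(** The jump at [-r] is left out: the path is not controlled before that time, so its left limit
    there carries no information. *)
Definition finite_quadratic_variation (r : R) l := forall b,
  (\esum_(u in `](- r)%R, b]) ((jump l u) ^+ 2)%:E < +oo)%E.

Section fixed.
Variables (r : R) (H : R -> R).
Hypothesis cH : cadlag_on (- r) +oo%E H.

Lemma kernel_right_continuous f s : continuous f ->
  forall x, - r <= x -> f (y - s) * H y @[y --> x^'+] --> f (x - s) * H x.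
Proof.
move=> cf x rx; apply: cvgM; last exact: cH.1 (ltry _).
apply: cvg_at_right_filter; apply: continuous_comp; last exact: cf.
by apply: cvgB => //; exact: cvg_cst.
Qed.

Lemma kernel_integrable f s b c : continuous f ->
  (forall x, ~ (- c <= x <= 0) -> f x = 0) ->
  mu.-integrable `[- r, b] (EFin \o (fun u => f (u - s) * H u)).
Proof.
move=> cf f0.
have [K [K0 fK]] := compact_support_bounded cf f0.
have [M [M0 HM]] := cadlag_bounded (b) cH.
apply: (right_continuous_integrable (M := K * M)).
  exact: kernel_right_continuous.
by move=> x xb; rewrite normrM ler_pM //; exact: HM.
Qed.

(** The window moves with [s]. Over a fixed interval only the integrand depends on [s], and two
    times can be compared under one integral. *)
Lemma kernel_Rintegral_supp f s b c : 0 <= c <= r -> 0 <= s <= b ->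
  (forall x, ~ (- c <= x <= 0) -> f x = 0) ->
  \int[mu]_(u in `[s - c, s]) (f (u - s) * H u) =
  \int[mu]_(u in `[- r, b]) (f (u - s) * H u).
Proof.
move=> cr sb f0; apply: Rintegral_supp => u /=; rewrite !in_itv /=; first by lra.
move=> ub us; rewrite f0 ?mul0r // => us'; apply: us; lra.
Qed.

Lemma kernel_Rintegral_right_continuous f c : 0 <= c <= r -> continuous f ->
  (forall x, ~ (- c <= x <= 0) -> f x = 0) -> forall s, 0 <= s ->
  \int[mu]_(u in `[s' - c, s']) (f (u - s') * H u) @[s' --> s^'+] -->
  \int[mu]_(u in `[s - c, s]) (f (u - s) * H u).
Proof.
move=> cr cf f0 s s0; apply/cvgrPdist_le => e e0.
have [M [M0 HM]] := cadlag_bounded (s + 1) cH.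
(* The admissible change of the kernel, chosen so that [d * (M + 1) * (s + 1 + r) = e]; [M + 1] in
   place of [M] keeps the divisor positive. *)
pose d := e / ((M + 1) * (s + 1 + r)).
have d0 : 0 < d by rewrite divr_gt0 // mulr_gt0; lra.
near=> s'.
have ss' : s < s' by near: s'; exact: nbhs_right_gt.
have s'1 : s' < s + 1 by near: s'; apply: nbhs_right_lt; rewrite ltrDl.
have hd u : - r <= u <= s + 1 -> `|f (u - s) - f (u - s')| <= d.
  move: u; near: s'; apply: cvg_within; exact: near_translate_le.
rewrite (kernel_Rintegral_supp (b := s + 1) cr _ f0); last by lra.
rewrite (kernel_Rintegral_supp (b := s + 1) cr _ f0); last by lra.
have i1 := kernel_integrable s (s + 1) cf f0.
have i2 := kernel_integrable s' (s + 1) cf f0.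
rewrite -RintegralB //.
have -> : e = d * (M + 1) * (s + 1 - (- r)).
  rewrite /d opprK -mulrA mulfVK // mulf_neq0 //; apply/eqP; lra.
apply: normr_Rintegral_itv_le; first by lra.
  exact: (integrableB _ i1 i2).
move=> u ur; rewrite -mulrBl normrM; apply: ler_pM => //; first exact: hd.
by apply: le_trans (HM _ ur) _; lra.
Unshelve. all: by end_near. Qed.

Variables (l : R -> R) (kappa : R).
Hypothesis lfin : finite_quadratic_variation r l.

Lemma jump_esum_ub b : exists V, 0 <= V /\
  forall a, - r <= a -> 
  (\esum_(u in `]a, b]) ((jump l u) ^+ 2)%:E <= V%:E)%E.
Proof.
have sq0 u : 0 <= (jump l u) ^+ 2 by exact: sqr_ge0.
have g0 : (0 <= \esum_(u in `](- r)%R, b]) ((jump l u) ^+ 2)%:E)%E.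
  by apply: esum_ge0 => u _; rewrite lee_fin.
exists (fine (\esum_(u in `](- r)%R, b]) ((jump l u) ^+ 2)%:E)%E).
split; first exact: fine_ge0.
move=> a ra; rewrite fineK ?ge0_fin_numE //; apply: subset_esum => // u /=.
by rewrite !in_itv /=; lra.
Qed.

Lemma leftlim_cadlag_le b M : (forall t, - r <= t <= b -> `|H t| <= M) ->
  forall t, - r < t <= b -> `|leftlim H t| <= M.
Proof.
move=> HM t tb; apply: (leftlim_norm_le (a := - r)); first by lra.
  by apply: cH.2; [lra|rewrite leey].
by move=> s rs st; apply: HM; lra.
Qed.

Lemma kernel_dS_term_le f s b M K u : (forall x, `|f x| <= K) ->
  (forall t, - r <= t <= b -> `|H t| <= M) -> - r < u <= b ->
  `|f (u - s) * leftlim H u * bigjump kappa l u| <= K * M * (jump l u) ^+ 2.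
Proof.
move=> fK HM ub; rewrite !normrM (ger0_norm (bigjump_ge0 _ _ _)).
apply: ler_pM; [by apply: mulr_ge0|exact: bigjump_ge0| |exact: bigjump_le].
by apply: ler_pM => //; exact: leftlim_cadlag_le HM _ ub.
Qed.

Lemma kernel_dS_supp f s b c : 0 <= c <= r -> 0 <= s <= b -> continuous f ->
  (forall x, ~ (- c <= x <= 0) -> f x = 0) ->
  dS kappa l (s - c) s (fun u => f (u - s) * leftlim H u) =
  dS kappa l (- r) b (fun u => f (u - s) * leftlim H u).
Proof.
move=> cr sb cf f0; rewrite !dSE; apply: ssum_supp => u /=; rewrite !in_itv /=; first by lra.
move=> ub us.
have [us'|/eqP us'] := eqVneq u (s - c); last first.
  by rewrite f0 ?mul0r // => us2; apply: us; lra.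
by rewrite us' addrAC subrr add0r (continuous_support_boundary cf f0) !mul0r.
Qed.

(** The window is again replaced by a fixed interval, on which the kernel moves by at most [d]. The
    jumps that enter in []s, s']] are covered too, since [f (u - s)] vanishes for [u > s]. *)
Lemma kernel_dS_right_continuous f c : 0 <= c <= r -> continuous f ->
  (forall x, ~ (- c <= x <= 0) -> f x = 0) -> forall s, 0 <= s ->
  dS kappa l (s' - c) s' (fun u => f (u - s') * leftlim H u) @[s' --> s^'+] -->
  dS kappa l (s - c) s (fun u => f (u - s) * leftlim H u).
Proof.
move=> cr cf f0 s s0; apply/cvgrPdist_le => e e0.
have [M [M0 HM]] := cadlag_bounded (s + 1) cH.
have [K [K0 fK]] := compact_support_bounded cf f0.
have [V [V0 /(_ _ (lexx _)) lV]] := jump_esum_ub (s + 1).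
pose d := e / ((M + 1) * (V + 1)).
have d0 : 0 < d by rewrite divr_gt0 // mulr_gt0; lra.
have sq0 u : 0 <= (jump l u) ^+ 2 by exact: sqr_ge0.
near=> s'.
have ss' : s < s' by near: s'; exact: nbhs_right_gt.
have s'1 : s' < s + 1 by near: s'; apply: nbhs_right_lt; rewrite ltrDl.
have hd u : - r <= u <= s + 1 -> `|f (u - s) - f (u - s')| <= d.
  move: u; near: s'; apply: cvg_within; exact: near_translate_le.
rewrite (@kernel_dS_supp f s (s + 1) c) //; last by lra.
rewrite (@kernel_dS_supp f s' (s + 1) c) //; last by lra.
have fin s2 : (\esum_(u in `](- r)%R, (s + 1)%R])
    (`|f (u - s2) * leftlim H u * bigjump kappa l u|)%:E < +oo)%E.
  apply: le_lt_trans (esum_normr_le (mulr_ge0 K0 M0) sq0 _ lV) (ltry _).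
  by move=> u /=; rewrite in_itv /=; exact: kernel_dS_term_le.
rewrite !dSE; apply: (@ssum_dist_le _ _ _ _ e) => //.
have eE : d * (M + 1) * V <= e.
  have -> : e = d * (M + 1) * (V + 1).
    by rewrite /d -mulrA mulfVK // mulf_neq0 //; apply/eqP; lra.
  by rewrite ler_wpM2l //; [rewrite mulr_ge0; lra|lra].
apply: le_trans (esum_normr_le _ sq0 _ lV) _; last by rewrite lee_fin; exact: eE.
  by rewrite mulr_ge0; lra.
move=> u /=; rewrite in_itv /= => ur.
rewrite -!mulrBl normrM (ger0_norm (bigjump_ge0 _ _ _)) normrM.
apply: ler_pM; [by apply: mulr_ge0|exact: bigjump_ge0| |exact: bigjump_le].
apply: ler_pM => //; first by apply: hd; lra.
by apply: le_trans (leftlim_cadlag_le HM _) _ => //; lra.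
Unshelve. all: by end_near. Qed.

Lemma kernel_dS_bounded f c b : 0 <= c <= r -> continuous f ->
  (forall x, ~ (- c <= x <= 0) -> f x = 0) -> 
  exists B, forall s, 0 <= s <= b ->
  `|dS kappa l (s - c) s (fun u => f (u - s) * leftlim H u)| <= B.
Proof.
move=> cr cf f0.
have [M [M0 HM]] := cadlag_bounded (b) cH.
have [K [K0 fK]] := compact_support_bounded cf f0.
have [V [V0 /(_ _ (lexx _)) lV]] := jump_esum_ub b.
have sq0 u : 0 <= (jump l u) ^+ 2 by exact: sqr_ge0.
exists (K * M * V) => s sb; rewrite (kernel_dS_supp cr sb cf f0) dSE.
(* The size of one sum is read as its distance to the sum of the zero function. *)
rewrite -[X in `|X|]subr0 -(_ : ssum `]- r, b] (cst 0) = 0); last first.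
  by rewrite /ssum !esum1 ?subee //= => u _; rewrite ?oppr0 maxxx.
apply: ssum_dist_le.
- apply: le_lt_trans (esum_normr_le (mulr_ge0 K0 M0) sq0 _ lV) (ltry _).
  by move=> u /=; rewrite in_itv /=; exact: kernel_dS_term_le.
- by rewrite esum1 ?ltry // => u _; rewrite normr0.
- apply: esum_normr_le lV => //; first exact: mulr_ge0.
  by move=> u /=; rewrite in_itv /= subr0; exact: kernel_dS_term_le.
Qed.

Lemma drift_right_continuous eta c_mu p q f_mu f_nu : 0 <= p <= r -> 0 <= q <= r ->
  continuous f_mu -> (forall x, ~ (- p <= x <= 0) -> f_mu x = 0) ->
  continuous f_nu -> (forall x, ~ (- q <= x <= 0) -> f_nu x = 0) ->
  forall s, 0 <= s ->
  drift eta c_mu p q f_mu f_nu kappa l H s' @[s' --> s^'+] -->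
  drift eta c_mu p q f_mu f_nu kappa l H s.
Proof.
move=> pr qr cfm fm0 cfn fn0 s s0; rewrite /drift.
apply: cvgD; first apply: cvgD; first apply: cvgB.
- exact: cvg_cst.
- by apply: cvgM; [exact: cvg_cst|apply: cH.1 (ltry _); lra].
- exact: (kernel_Rintegral_right_continuous pr cfm fm0 s0).
- exact: (kernel_dS_right_continuous qr cfn fn0 s0).
Qed.

(** Right continuity supplies measurability in time. Integrability is what allows the drift
    integrals of the two equations to be subtracted. *)
Lemma drift_integrable eta c_mu p q f_mu f_nu b : 0 <= p <= r -> 0 <= q <= r ->
  continuous f_mu -> (forall x, ~ (- p <= x <= 0) -> f_mu x = 0) ->
  continuous f_nu -> (forall x, ~ (- q <= x <= 0) -> f_nu x = 0) ->
  mu.-integrable `[0, b] (EFin \o drift eta c_mu p q f_mu f_nu kappa l H).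
Proof.
move=> pr qr cfm fm0 cfn fn0.
have [M [M0 HM]] := cadlag_bounded (b) cH.
have [K [K0 fK]] := compact_support_bounded cfm fm0.
have [B hB] := kernel_dS_bounded b qr cfn fn0.
apply: (@right_continuous_integrable _ _ _
  (`|eta| + `|c_mu| * M + K * M * p + B)).
  exact: drift_right_continuous.
move=> s sb; rewrite /drift.
apply: le_trans (ler_normD _ _) _; apply: lerD; last exact: hB.
apply: le_trans (ler_normD _ _) _; apply: lerD.
  apply: le_trans (ler_normB _ _) _; rewrite lerD2l normrM ler_wpM2l //.
  by apply: HM; lra.
have -> : K * M * p = K * M * (s - (s - p)) by ring.
apply: normr_Rintegral_itv_le; first by lra.
  apply: integrableS (kernel_integrable s b cfm fm0) => //.
  by move=> u /=; rewrite !in_itv /=; lra.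
by move=> u us; rewrite normrM ler_pM //; apply: HM; lra.
Qed.

End fixed.
End Kernels.

(** * Pathwise stability estimate in an exponentially weighted norm *)

Section Stability.
Context {R : realType}.
Local Notation mu := (@lebesgue_measure R).

Lemma Rintegral_expRD_cst (A B lam t : R) : 0 < lam -> 0 < t ->
  \int[mu]_(s in `[0, t]) (A * expR (lam * s) + B) =
  A * (expR (lam * t) - 1) / lam + B * t.
Proof.
move=> lam0 t0.
pose G s := A / lam * expR (lam * s) + B * s.
have dG (s : R) : is_derive s 1 G (A * expR (lam * s) + B).
  rewrite /G; apply: is_derive_eq.
  by rewrite /GRing.scale /=; field; rewrite gt_eqF.
have cE : continuous (fun s => A * expR (lam * s) + B).
  move=> s; apply: cvgD; last exact: cvg_cst.
  apply: cvgM; first exact: cvg_cst.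
  apply: continuous_comp; last exact: continuous_expR.
  by apply: cvgM => //; exact: cvg_cst.
rewrite /Rintegral (@continuous_FTC2 _ (fun s => A * expR (lam * s) + B) G 0 t) //.
- by rewrite /G -EFinB /= !mulr0 expR0 mulr1; field; rewrite gt_eqF.
- exact: continuous_subspaceT.
- split.
  + by move=> s _; case: (dG s).
  + by apply: cvg_at_right_filter; apply: differentiable_continuous; apply/derivable1_diffP; case: (dG 0).
  + by apply: cvg_at_left_filter; apply: differentiable_continuous; apply/derivable1_diffP; case: (dG t).
- by move=> s _; rewrite derive1E; case: (dG s).
Qed.

Variables (r p q eta c_mu c_nu : R) (f_mu f_nu l x : R -> R) (T : R).
Hypotheses (pr : 0 <= p <= r) (qr : 0 <= q <= r).
Hypotheses (cmu0 : 0 < c_mu) (cnu0 : 0 < c_nu) (T0 : 0 < T).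
Hypotheses (cfm : continuous f_mu) (fm0 : forall u, ~ (- p <= u <= 0) -> f_mu u = 0).
Hypotheses (cfn : continuous f_nu) (fn0 : forall u, ~ (- q <= u <= 0) -> f_nu u = 0).
Hypothesis (lfin : finite_quadratic_variation r l).
Hypothesis (cx : cadlag_on (- r) +oo%E x).

Let p0 : 0 <= p. Proof. by case/andP: pr. Qed.
Let q0 : 0 <= q. Proof. by case/andP: qr. Qed.
Let p_le_r : p <= r. Proof. by case/andP: pr. Qed.
Let q_le_r : q <= r. Proof. by case/andP: qr. Qed.
Let r0 : 0 <= r. Proof. exact: le_trans p0 p_le_r. Qed.

Ltac lra_params := move: p0 p_le_r q0 q_le_r r0 cmu0 cnu0 T0 => *; lra.

Let j (u : R) : R := (jump l u) ^+ 2.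
(** [m] is the left limit of [S]. Both count all squared jumps after time 0, whatever the threshold,
    so the weight built on [S] is the same for every approximation. *)
Let m (u : R) : R := fine (\esum_(v in `]0%R, u[) (j v)%:E)%E.
Let S (u : R) : R := fine (\esum_(v in `]0%R, u]) (j v)%:E)%E.

Let j0 u : 0 <= j u. Proof. exact: sqr_ge0. Qed.

Let fin_sub (A : set R) b : A `<=` `](- r)%R, b] ->
  (\esum_(v in A) (j v)%:E)%E \is a fin_num.
Proof.
move=> Ab; rewrite ge0_fin_numE; last by apply: esum_ge0 => u _; rewrite lee_fin.
exact: le_lt_trans (subset_esum Ab j0) (lfin b).
Qed.

Let fin_S u : (\esum_(v in `]0%R, u]) (j v)%:E)%E \is a fin_num.
Proof. by apply: (@fin_sub _ u) => v /=; rewrite !in_itv /=; lra_params. Qed.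

Let fin_m u : (\esum_(v in `]0%R, u[) (j v)%:E)%E \is a fin_num.
Proof. by apply: (@fin_sub _ u) => v /=; rewrite !in_itv /=; lra_params. Qed.

Let S_le_m u v : u < v -> S u <= m v.
Proof.
move=> uv; rewrite -lee_fin !fineK //; apply: subset_esum => // w /=.
by rewrite !in_itv /=; lra_params.
Qed.

Let mD_le_S u v : 0 < u <= v -> m u + j u <= S v.
Proof.
move=> uv; rewrite -lee_fin EFinD !fineK //.
rewrite [leRHS](esumID `]0, u[%classic) //; last by move=> *; rewrite lee_fin.
apply: leeD.
  by apply: subset_esum => // w /=; rewrite !in_itv /=; lra_params.
rewrite -(@esum_set1 _ _ u (fun u => (j u)%:E)) ?lee_fin //.
apply: subset_esum => // w /= ->; rewrite !in_itv /=; split; lra_params.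
Qed.

Let mD_le_m u v : 0 < u -> u < v -> m u + j u <= m v.
Proof. by move=> u0 uv; apply: le_trans (S_le_m uv); apply: mD_le_S; lra_params. Qed.

Let S_mono u v : u <= v -> S u <= S v.
Proof.
move=> uv; rewrite -lee_fin !fineK //; apply: subset_esum => // w /=.
by rewrite !in_itv /=; lra_params.
Qed.

Let S_ge0 u : 0 <= S u.
Proof. by apply: fine_ge0; apply: esum_ge0 => v _; rewrite lee_fin. Qed.

Let c : R := 4 * c_nu.
Let c0 : 0 < c. Proof. by rewrite /c; lra_params. Qed.

Variables (Kmu Knu M : R).
Hypotheses (fmK : forall u, `|f_mu u| <= Kmu) (fnK : forall u, `|f_nu u| <= Knu).
Hypothesis (xM : forall t, - r <= t <= T -> `|x t| <= M).
Let Kmu0 : 0 <= Kmu. Proof. exact: le_trans (fmK 0). Qed.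
Let Knu0 : 0 <= Knu. Proof. exact: le_trans (fnK 0). Qed.
Let M0 : 0 <= M. Proof. by apply: le_trans (xM (t := 0) _) => //; lra_params. Qed.

(** The rate at which the drift responds to a weighted difference of paths: [c_mu] from the linear
    term, [p * Kmu] from the integral over a window of length [p], and [Knu / c] from the jump sum,
    where the weight gains [1 / c]. *)
Let K1 : R := c_mu + p * Kmu + Knu / c.
Let lam : R := 4 * K1.
Let K10 : 0 < K1.
Proof.
have := divr_ge0 Knu0 (ltW c0); have := mulr_ge0 p0 Kmu0.
by rewrite /K1; lra_params.
Qed.
Let lam0 : 0 < lam. Proof. by move: K10; rewrite /lam; lra_params. Qed.

(* The weight absorbs the growth of the solution: integrating it against [ds] over
   [0, t] gains the factor [1 / lam], and against [dS] (through its left limits) the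
   factor [1 / c].  With these values of [lam] and [c] the equation for [y - x]
   contracts the weighted supremum norm by [1 / 2]. *)
Definition stability_weight (t : R) : R := expR (lam * t) * expR (c * S t).
Local Notation W := stability_weight.

Let W_mono s t : s <= t -> W s <= W t.
Proof.
move=> st; rewrite /W ler_pM ?expR_ge0 // ler_expR.
  by rewrite ler_wpM2l // ltW.
by rewrite ler_wpM2l ?S_mono // ltW.
Qed.

Let W_ge1 t : 0 <= t -> 1 <= W t.
Proof.
move=> t0; rewrite /W -expRD -expR0 ler_expR.
by rewrite addr_ge0 // mulr_ge0 // ltW.
Qed.

Variables (kappa rho : R) (y : R -> R).
Hypothesis (cy : cadlag_on (- r) +oo%E y).
Hypothesis (rho0 : 0 <= rho).
Hypothesis (rhoE :
  (\esum_(u in `](- r)%R, T]) (j u - bigjump kappa l u)%:E <= rho%:E)%E).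
Hypothesis (yx : forall t, - r <= t <= 0 -> y t = x t).

Let jk0 u : 0 <= j u - bigjump kappa l u.
Proof. by rewrite subr_ge0; exact: bigjump_le. Qed.

Section fixed_bound.
(** [N] is an a priori bound on the difference in the weighted norm; the estimates below return
    [N / 2] plus a multiple of [rho]. *)
Variable N : R.
Hypothesis N0 : 0 <= N.
Hypothesis zN : forall t, 0 <= t <= T -> `|y t - x t| <= N * W t.

(** The weight increases, so its value at [t] controls the whole past, including the initial segment
    where the paths agree. The delay window of the drift needs this. *)
Let z_le s t : - r <= s <= t -> 0 <= t <= T -> `|y s - x s| <= N * W t.
Proof.
move=> st tT; have [s0|s0] := leP s 0.
  rewrite yx ?subrr ?normr0; last by lra_params.
  by rewrite !mulr_ge0 ?expR_ge0.
apply: le_trans (zN _) _; first by lra_params.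
by rewrite ler_wpM2l //; apply: W_mono; lra_params.
Qed.

Let leftlim_diff u : - r < u ->
  leftlim y u - leftlim x u = leftlim (fun v => y v - x v) u.
Proof. by move=> ru; rewrite leftlimB //; [apply: cy.2|apply: cx.2]; rewrite ?leey. Qed.

Let cvg_diff u : - r < u -> cvg (y v - x v @[v --> u^'-]).
Proof. by move=> ru; apply: is_cvgB; [apply: cy.2|apply: cx.2]; rewrite ?leey. Qed.

Let leftlim_le0 u : - r < u <= 0 -> leftlim y u = leftlim x u.
Proof.
move=> ru; apply/eqP; rewrite -subr_eq0 -normr_le0 leftlim_diff; last by lra_params.
apply: (leftlim_norm_le (a := - r)); [lra_params|apply: cvg_diff; lra_params|].
by move=> s rs su; rewrite yx ?subrr ?normr0 //; lra_params.
Qed.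

(** The left limit sees only times [s < u], for which [S s <= m u]; the bound therefore does not
    contain the jump at [u] itself, and the sum over jumps can telescope. *)
Let leftlim_le u : 0 < u <= T ->
  `|leftlim y u - leftlim x u| <= N * (expR (lam * u) * expR (c * m u)).
Proof.
move=> uT; rewrite leftlim_diff; last by lra_params.
apply: (leftlim_norm_le (a := 0)); [lra_params|apply: cvg_diff; lra_params|].
move=> s s0 su; apply: le_trans (zN _) _; first by lra_params.
rewrite ler_wpM2l // ler_pM ?expR_ge0 // ler_expR.
  by apply: ler_wpM2l; exact: ltW.
by apply: ler_wpM2l; [exact: ltW|exact: S_le_m].
Qed.

(** Majorant of one term of the jump sum. It vanishes for [u <= 0], where the left limits coincide;
    the time factor is taken at [t] instead of [u <= t], so that it leaves the sum. *)
Let g t (u : R) : R := if 0 < u then N * expR (lam * t) * (expR (c * m u) * j u) else 0.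

Let g_ge0 t u : 0 <= g t u.
Proof. 
rewrite /g; case: ifP => // _.
by apply: mulr_ge0; apply: mulr_ge0 => //; exact: expR_ge0. Qed.

(** Telescoping bounds the sum of [expR (c * m u) * j u] by [expR (c * S t) / c]: this is the gain
    of [1 / c]. *)
Let esum_g_le a t : - r <= a -> 0 <= t <= T ->
  (\esum_(u in `]a, t]) (g t u)%:E <= (N * W t / c)%:E)%E.
Proof.
move=> ra tT.
apply: (@le_trans _ _ (\esum_(u in `](- r)%R, t]) (g t u)%:E)%E).
  by apply: subset_esum => // u /=; rewrite !in_itv /=; lra_params.
rewrite -(@esum_supp _ `]0, t]%classic); last 2 first.
- by move=> u /=; rewrite !in_itv /=; lra_params.
- move=> u /=; rewrite !in_itv /= /g => ut u0; case: ifP => // u0'.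
  by exfalso; apply: u0; rewrite u0'; lra_params.
rewrite (@eq_esum _ _ _ _ (fun u => (N * expR (lam * t) * (expR (c * m u) * j u))%:E));
  last by move=> u /=; rewrite in_itv /= /g => /andP[-> _].
have -> : N * W t / c = N * expR (lam * t) * (expR (c * S t) / c).
  by rewrite /W; ring.
apply: esumZ_le.
- by rewrite mulr_ge0 ?expR_ge0.
- by move=> u; rewrite mulr_ge0 ?expR_ge0.
- apply: esum_le_sorted => s ss sA; apply: (sum_expR_sorted_le (a := 0)) => //.
  move=> u /sA /=; rewrite in_itv /= => ut; split; first by lra_params.
  exact: mD_le_S.
Qed.

(** The difference of the integrands splits into the difference of the left limits against the
    retained jumps, paid by [g], and [leftlim x] against the discarded ones, paid by [rho]; the
    threshold 0 discards nothing. The factor [w] is either the delay kernel or the constant 1. *)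
Let dS_diff_le (w : R -> R) K a t : - r <= a -> 0 <= t <= T ->
  (forall u, `|w u| <= K) ->
  `|dS kappa l a t (fun u => w u * leftlim y u) -
    dS 0 l a t (fun u => w u * leftlim x u)| <= K * (N * W t / c + M * rho).
Proof.
move=> ra tT wK.
have K0 : 0 <= K by exact: le_trans (wK 0).
have fin kap H : cadlag_on (- r) +oo%E H ->
   (\esum_(u in `]a, t]) (`|w u * leftlim H u * bigjump kap l u|)%:E < +oo)%E.
  move=> cH; have [B [B0 HB]] := cadlag_bounded T cH.
  have [V [V0 lV]] := jump_esum_ub lfin t.
  apply: le_lt_trans (esum_normr_le (mulr_ge0 K0 B0) j0 _ (lV a ra)) (ltry _).
  move=> u /=; rewrite in_itv /= => ut.
  (* That bound concerns a shifted kernel; [w] translated by [u] and shifted back gives [w u]. *)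
  have := @kernel_dS_term_le _ r H cH l kap (fun v => w (v + u)) u T B K u.
  by rewrite subrr add0r; apply => //; lra_params.
rewrite !dSE; apply: ssum_dist_le; [exact: fin|exact: fin|].
apply: (@le_trans _ _ (\esum_(u in `]a, t])
    (K * (g t u + M * (j u - bigjump kappa l u)))%:E)%E).
  apply: le_esum => u /=; rewrite in_itv /= => ut; rewrite lee_fin.
  have -> : w u * leftlim y u * bigjump kappa l u - w u * leftlim x u * bigjump 0 l u
    = w u * ((leftlim y u - leftlim x u) * bigjump kappa l u
             - leftlim x u * (j u - bigjump kappa l u)).
    by rewrite {2}/bigjump normr_ge0 /j; ring.
  rewrite normrM ler_pM //; apply: le_trans (ler_normB _ _) _.
  apply: lerD; rewrite normrM.
    rewrite (ger0_norm (bigjump_ge0 _ _ _)) /g; case: ifP => [u0|/negbT].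
      rewrite [leRHS]mulrA; apply: ler_pM => //; first exact: bigjump_ge0.
        apply: le_trans (leftlim_le _) _; first by lra_params.
        rewrite mulrA ler_wpM2r ?expR_ge0 // ler_wpM2l // ler_expR ler_wpM2l //.
          exact: ltW.
        by lra_params.
      exact: bigjump_le.
    by rewrite -leNgt => u0; rewrite leftlim_le0 ?subrr ?normr0 ?mul0r //; lra_params.
  rewrite (ger0_norm (jk0 _)) ler_wpM2r //.
  by apply: (leftlim_cadlag_le cx xM); lra_params.
apply: esumZ_le => //.
  by move=> u; rewrite addr_ge0 ?g_ge0 // mulr_ge0.
rewrite (@eq_esum _ _ _ _ (fun u => (g t u)%:E + (M * (j u - bigjump kappa l u))%:E)%E) //.
rewrite esumD; [|by move=> *; rewrite lee_fin|by move=> *; rewrite lee_fin mulr_ge0].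
rewrite EFinD; apply: leeD; first exact: esum_g_le.
apply: esumZ_le => //; apply: le_trans rhoE; apply: subset_esum => // u /=.
by rewrite !in_itv /=; lra_params.
Qed.

Let drift_y := drift eta c_mu p q f_mu f_nu kappa l y.
Let drift_x := drift eta c_mu p q f_mu f_nu 0 l x.

Let drift_diff_le s : 0 <= s <= T ->
  `|drift_y s - drift_x s| <= K1 * N * W s + Knu * M * rho.
Proof.
move=> sT; rewrite /drift_y /drift_x /drift.
set Iy := \int[_]_(u in _) _; set Ix := \int[_]_(u in _) _.
set Dy := dS _ _ _ _ _; set Dx := dS _ _ _ _ _.
have -> : eta - c_mu * y s + Iy + Dy - (eta - c_mu * x s + Ix + Dx) =
   (Dy - Dx) + (Iy - Ix) - c_mu * (y s - x s) by ring.
have hD : `|Dy - Dx| <= Knu * (N * W s / c + M * rho).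
  by apply: (@dS_diff_le (fun u => f_nu (u - s))) => //; lra_params.
have hI : `|Iy - Ix| <= Kmu * (N * W s) * (s - (s - p)).
  have iK H : cadlag_on (- r) +oo%E H ->
      mu.-integrable `[s - p, s] (EFin \o (fun u => f_mu (u - s) * H u)).
    move=> cH; apply: integrableS (kernel_integrable cH s s cfm fm0) => //.
    by move=> u /=; rewrite !in_itv /=; lra_params.
  have iy := iK _ cy; have ix := iK _ cx.
  rewrite -RintegralB //; apply: normr_Rintegral_itv_le; first by lra_params.
    exact: (integrableB _ iy ix).
  move=> u us; rewrite -mulrBr normrM ler_pM //; apply: z_le; lra_params.
have hz : `|c_mu * (y s - x s)| <= c_mu * (N * W s).
  by rewrite normrM (gtr0_norm cmu0) ler_pM2l //; apply: zN.
have h1 := ler_normB ((Dy - Dx) + (Iy - Ix)) (c_mu * (y s - x s)).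
have h2 := ler_normD (Dy - Dx) (Iy - Ix).
have -> : K1 * N * W s + Knu * M * rho =
   Knu * (N * W s / c + M * rho) + Kmu * (N * W s) * (s - (s - p)) + c_mu * (N * W s).
  by rewrite /K1; ring.
by lra_params.
Qed.

Let drift_y_int t : mu.-integrable `[0, t] (EFin \o drift_y).
Proof. by apply: (@drift_integrable _ r). Qed.

Let drift_x_int t : mu.-integrable `[0, t] (EFin \o drift_x).
Proof. by apply: (@drift_integrable _ r). Qed.

(** Replacing [S s] by [S t] leaves an explicit exponential in [s], whose integral is at most
    [expR (lam * t) / lam]; the factor 1/4 is [K1 / lam]. *)
Let drift_Rintegral_le t : 0 <= t <= T ->
  `|\int[mu]_(s in `[0, t]) drift_y s - \int[mu]_(s in `[0, t]) drift_x s|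
  <= N * W t / 4 + Knu * M * rho * T.
Proof.
move=> tT.
have B0 : 0 <= Knu * M * rho by rewrite !mulr_ge0.
have W0 : 0 <= W t by rewrite mulr_ge0 ?expR_ge0.
(* The explicit integral is computed for [0 < t] only. *)
have [t0|t0] := eqVneq t 0.
  have i0 f : \int[mu]_(s in `[0, t]) f s = 0 :> R.
    by rewrite t0 set_itv1 Rintegral_set1.
  rewrite !i0 subrr normr0 addr_ge0 //; last by rewrite mulr_ge0 // ltW.
  by rewrite divr_ge0 // mulr_ge0.
have {}t0 : 0 < t by rewrite lt_def t0; lra_params.
rewrite -RintegralB //.
have iB : mu.-integrable `[0, t] (EFin \o (fun s => drift_y s - drift_x s)).
  exact: (integrableB _ (drift_y_int t) (drift_x_int t)).
apply: le_trans (le_normr_Rintegral _ iB) _ => //.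
pose A := K1 * N * expR (c * S t).
apply: (@le_trans _ _ (\int[mu]_(s in `[0, t]) (A * expR (lam * s) + Knu * M * rho))).
  apply: le_Rintegral => //.
  - by move/integrable_abse : iB.
  - apply: (right_continuous_integrable (M := A * expR (lam * t) + Knu * M * rho)).
      move=> s _; apply: cvg_at_right_filter; apply: cvgD; last exact: cvg_cst.
      apply: cvgM; first exact: cvg_cst.
      apply: continuous_comp; last exact: continuous_expR.
      by apply: cvgM => //; exact: cvg_cst.
    move=> s st; have A0 : 0 <= A by rewrite /A !mulr_ge0 ?expR_ge0 // ltW.
    rewrite ger0_norm; last by rewrite addr_ge0 // mulr_ge0 // expR_ge0.
    rewrite lerD2r ler_wpM2l // ler_expR ler_wpM2l //; last by lra_params.
    exact: ltW.
  - move=> s /=; rewrite in_itv /= => st; apply: le_trans (drift_diff_le _) _; first by lra_params.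
    have -> : A * expR (lam * s) = K1 * N * (expR (lam * s) * expR (c * S t)).
      by rewrite /A; ring.
    rewrite lerD2r; apply: ler_wpM2l; first by rewrite mulr_ge0 // ltW.
    apply: ler_wpM2l; first exact: expR_ge0.
    rewrite ler_expR; apply: ler_wpM2l; first exact: ltW.
    by apply: S_mono; lra_params.
rewrite Rintegral_expRD_cst //; apply: lerD; last by rewrite ler_wpM2l //; lra_params.
have -> : N * W t / 4 = A * expR (lam * t) / lam.
  have alg (a b n k : R) : 0 < k -> n * (a * b) / 4 = k * n * b * a / (4 * k).
    by move=> k0; field; rewrite gt_eqF.
  exact: alg.
rewrite ler_pM2r ?invr_gt0 // ler_wpM2l //; last by lra_params.
by rewrite /A !mulr_ge0 ?expR_ge0 // ltW.
Qed.

Hypothesis eqy : forall t, 0 <= t -> y t = y 0 + \int[mu]_(s in `[0, t]) drift_y s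
  + c_nu * dS kappa l 0 t (leftlim y).
Hypothesis eqx : forall t, 0 <= t -> x t = x 0 + \int[mu]_(s in `[0, t]) drift_x s
  + c_nu * dS 0 l 0 t (leftlim x).

(** The drift contributes a quarter of [N * W t] because [K1 / lam = 1/4], the jump term another
    quarter because [c_nu / c = 1/4]. *)
Lemma stability_step t : 0 <= t <= T ->
  `|y t - x t| <= N / 2 * W t + (Knu * T + c_nu) * M * rho.
Proof.
move=> tT; have [t0 _] := andP tT; rewrite (eqy t0) (eqx t0).
have dSE1 kap H : dS kap l 0 t (leftlim H) = dS kap l 0 t (fun u => 1 * leftlim H u).
  by congr (dS _ _ _ _ _); apply/funext => u; rewrite mul1r.
have h1 := drift_Rintegral_le tT.
have h2 : `|dS kappa l 0 t (leftlim y) - dS 0 l 0 t (leftlim x)| <=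
    1 * (N * W t / c + M * rho).
  by rewrite !dSE1; apply: dS_diff_le => //; [lra_params|move=> u; rewrite normr1].
set Iy := \int[mu]_(s in _) drift_y s in h1 *.
set Ix := \int[mu]_(s in _) drift_x s in h1 *.
set Dy := dS kappa l 0 t _ in h2 *; set Dx := dS 0 l 0 t _ in h2 *.
rewrite (yx (t := 0)); last by lra_params.
have -> : x 0 + Iy + c_nu * Dy - (x 0 + Ix + c_nu * Dx) = (Iy - Ix) + c_nu * (Dy - Dx).
  by ring.
apply: le_trans (ler_normD _ _) _; rewrite normrM (gtr0_norm cnu0).
apply: le_trans (lerD h1 (ler_wpM2l (ltW cnu0) h2)) _.
rewrite le_eqVlt; apply/orP; left; apply/eqP.
have alg (n w v : R) : 0 < v ->
    n * w / 4 + Knu * M * rho * T + v * (1 * (n * w / (4 * v) + M * rho)) =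
    n / 2 * w + (Knu * T + v) * M * rho.
  by move=> v0; field; rewrite gt_eqF.
exact: alg.
Qed.

End fixed_bound.

Hypothesis eqy : forall t, 0 <= t -> y t = y 0 +
  \int[mu]_(s in `[0, t]) drift eta c_mu p q f_mu f_nu kappa l y s
  + c_nu * dS kappa l 0 t (leftlim y).
Hypothesis eqx : forall t, 0 <= t -> x t = x 0 +
  \int[mu]_(s in `[0, t]) drift eta c_mu p q f_mu f_nu 0 l x s
  + c_nu * dS 0 l 0 t (leftlim x).

(** Both paths are bounded on [[-r, T]], so the weighted supremum of the difference over [[0, T]] is
    finite and can itself serve as [N]. The step then gives [sup Z <= sup Z / 2 + E], that is,
    [sup Z <= 2 * E]. *)
Lemma stability t : - r <= t <= T ->
  `|y t - x t| <= 2 * ((Knu * T + c_nu) * M * rho) * W T.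
Proof.
set E := _ * rho.
have E0 : 0 <= E by rewrite /E !mulr_ge0 // addr_ge0 ?(ltW cnu0) // mulr_ge0 // ltW.
have [My [My0 yM]] := cadlag_bounded T cy.
pose Z := [set `|y s - x s| / W s | s in `[0, T]%classic].
have W0 s : 0 < W s by rewrite mulr_gt0 ?expR_gt0.
have supZ : has_sup Z.
  split; first by exists (`|y 0 - x 0| / W 0), 0 => //=; rewrite in_itv /=; lra_params.
  exists (My + M) => z [s /=]; rewrite in_itv /= => sT <-.
  rewrite ler_pdivrMr //; apply: (@le_trans _ _ (My + M)).
    apply: le_trans (ler_normB _ _) _; apply: lerD; [apply: yM|apply: xM]; lra_params.
  by rewrite ler_peMr ?addr_ge0 // W_ge1 //; lra_params.
have zZ s : 0 <= s <= T -> `|y s - x s| <= sup Z * W s.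
  move=> sT; rewrite -ler_pdivrMr //; apply: ub_le_sup; first by case: supZ.
  by exists s => //=; rewrite in_itv.
have Z0 : 0 <= sup Z.
  apply: le_trans (ub_le_sup supZ.2 _); last first.
    by exists 0 => //=; rewrite in_itv /=; lra_params.
  by rewrite divr_ge0 // ltW.
have Zle : sup Z <= sup Z / 2 + E.
  apply: ge_sup; first by case: supZ.
  move=> z [s /=]; rewrite in_itv /= => sT <-; rewrite ler_pdivrMr // mulrDl.
  apply: le_trans (stability_step Z0 zZ eqy eqx sT) _; rewrite lerD2l.
  by rewrite ler_peMr // W_ge1 //; lra_params.
move=> tT; have [t0|t0] := leP t 0.
  rewrite yx ?subrr ?normr0; last by lra_params.
  by apply: mulr_ge0; [apply: mulr_ge0|exact: ltW].
apply: le_trans (zZ t _) _; first by lra_params.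
have E2 : sup Z <= 2 * E by lra_params.
by apply: ler_pM => //; [exact: ltW|apply: W_mono; lra_params].
Qed.
End Stability.

(** * The mass of the discarded jumps tends to zero *)

Section SmallJumps.
Context {R : realType}.
Implicit Types l : R -> R.

Lemma near_forall_seq {I : eqType} (s : seq I) (Q : nat -> I -> Prop) :
  (forall x, x \in s -> \forall n \near \oo, Q n x) ->
  \forall n \near \oo, forall x, x \in s -> Q n x.
Proof.
elim: s => [_|x s IH sQ]; first by near=> n.
have hx := sQ x (mem_head _ _).
have hs : \forall n \near \oo, forall x, x \in s -> Q n x.
  by apply: IH => y ys; apply: sQ; rewrite in_cons ys orbT.
near=> n => y; rewrite in_cons => /orP[/eqP ->|ys].
  by near: n; exact: hx.
by move: y ys; near: n; exact: hs.
Unshelve. all: by end_near. Qed.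

Lemma bigjump_near l (s : seq R) : \forall n \near \oo,
  forall u, u \in s -> bigjump n%:R^-1 l u = (jump l u) ^+ 2.
Proof.
apply: near_forall_seq => x _.
have [j0|j0] := eqVneq (jump l x) 0.
  by near=> n; rewrite /bigjump j0 expr0n /=; case: ifP.
near=> n; rewrite /bigjump ifT //.
have n0 : 0 < n%:R :> R by rewrite ltr0n; near: n; exact: nbhs_infty_gt.
rewrite invf_ple ?posrE ?normr_gt0 //.
by near: n; exact: nbhs_infty_ger.
Unshelve. all: by end_near. Qed.

(** A finite set of times carries all but [e] of the total mass, and for large [n] none of its jumps
    is cut off; what is cut off then weighs at most [e]. *)
Lemma small_jumps_near l (A : set R) e : 0 < e ->
  (\esum_(u in A) ((jump l u) ^+ 2)%:E < +oo)%E ->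
  \forall n \near \oo,
  (\esum_(u in A) ((jump l u) ^+ 2 - bigjump n%:R^-1 l u)%:E <= e%:E)%E.
Proof.
move=> e0 jy.
have fin : (\esum_(u in A) ((jump l u) ^+ 2)%:E)%E \is a fin_num.
  by rewrite ge0_fin_numE // esum_ge0 // => u _; rewrite lee_fin sqr_ge0.
have [_ [X XA <-] hX] := ub_ereal_sup_adherent e0 fin.
have [finX subX] := XA.
near=> n.
have nE : forall u, u \in enum_fset (fset_set X) -> bigjump n%:R^-1 l u = (jump l u) ^+ 2.
  by near: n; exact: bigjump_near.
have bE : (\esum_(u in A) ((jump l u) ^+ 2 - bigjump n%:R^-1 l u)%:E +
    \esum_(u in A) (bigjump n%:R^-1 l u)%:E = \esum_(u in A) ((jump l u) ^+ 2)%:E)%E.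
  rewrite -esumD.
  - by apply: eq_esum => u _; rewrite -EFinD subrK.
  - by move=> u _; rewrite lee_fin subr_ge0 bigjump_le.
  - by move=> u _; rewrite lee_fin bigjump_ge0.
have bX : (\sum_(u \in X) ((jump l u) ^+ 2)%:E <=
    \esum_(u in A) (bigjump n%:R^-1 l u)%:E)%E.
  apply: esum_ge; exists X => //; rewrite !fsbig_finite //=.
  rewrite le_eqVlt; apply/orP; left; apply/eqP; apply: eq_big_seq => u uX.
  by rewrite nE.
have bfin : (\esum_(u in A) (bigjump n%:R^-1 l u)%:E)%E \is a fin_num.
  rewrite ge0_fin_numE; last by apply: esum_ge0 => u _; rewrite lee_fin bigjump_ge0.
  by apply: le_lt_trans jy; apply: le_esum => u _; rewrite lee_fin bigjump_le.
have -> : (\esum_(u in A) ((jump l u) ^+ 2 - bigjump n%:R^-1 l u)%:E =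
    \esum_(u in A) ((jump l u) ^+ 2)%:E - \esum_(u in A) (bigjump n%:R^-1 l u)%:E)%E.
  by rewrite -bE addeK.
rewrite leeBlDr //; move: (lt_le_trans hX bX).
by rewrite lteBlDr // => /ltW; rewrite addeC.
Unshelve. all: by end_near. Qed.

End SmallJumps.

(** * From almost sure convergence to convergence in probability *)

Section ConvergenceInProbability.
Context {d : measure_display} {T : measurableType d} {R : realType}.
Variable P : probability T R.

(** The tail unions [B N] contain [A N] and decrease to the upper limit of the sets, which is null;
    continuity from above concludes. *)
Lemma ae_eventually_notin_cvg (A : nat -> set T) :
  (forall n, measurable (A n)) ->
  (\forall w \ae P, \forall n \near \oo, ~ A n w) ->
  P (A n) @[n --> \oo] --> 0%E.
Proof.
move=> mA aeA; pose B N := \bigcup_(n in [set n | (N <= n)%N]) A n.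
have mB N : measurable (B N) by apply: bigcup_measurable.
have mI : measurable (\bigcap_N B N) by apply: bigcap_measurable.
have PI : P (\bigcap_N B N) = 0%E.
  case: aeA => C [mC PC0 CA]; apply: (subset_measure0 mI mC _ PC0) => w Bw.
  apply: CA => /= -[N _ NA]; have [n /= Nn Anw] := Bw N I.
  exact: (NA n).
have cB : P (B N) @[N --> \oo] --> 0%E.
  rewrite -PI; apply: nonincreasing_cvg_mu => //.
    by apply: le_lt_trans (probability_le1 _ _) (ltry _).
  move=> n m nm; apply/subsetPset => w [k /= mk Akw].
  by exists k => //=; exact: leq_trans mk.
apply: (@squeeze_cvge _ _ _ _ (cst 0%E) _ (fun N => P (B N))) => //.
  near=> n; rewrite measure_ge0 /=; apply: le_measure; [exact: mem_set|exact: mem_set|].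
  by move=> w Aw; exists n => /=.
exact: cvg_cst.
Unshelve. all: by end_near. Qed.

(* By right continuity the supremum is approached along the rationals of [a, b[,
   except that the endpoint [b] has to be added. *)
Lemma measurable_sup_abs_diff (X Y : R -> T -> R) a b e : a <= b ->
  (forall t, a <= t <= b -> measurable_fun setT (X t)) ->
  (forall t, a <= t <= b -> measurable_fun setT (Y t)) ->
  (forall w t, a <= t -> X s w @[s --> t^'+] --> X t w) ->
  (forall w t, a <= t -> Y s w @[s --> t^'+] --> Y t w) ->
  measurable [set w | (e%:E < sup_abs_diff Y X a b w)%E].
Proof.
move=> ab mX mY rX rY.
pose E t := [set w | e < `|Y t w - X t w|].
have mE t : a <= t <= b -> measurable (E t).
  move=> tab; have mD : measurable_fun setT (fun w => `|Y t w - X t w|).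
    by apply: measurableT_comp => //; apply: measurable_funB; [exact: mY|exact: mX].
  have := mD measurableT `]e, +oo[%classic (measurable_itv _).
  rewrite setTI; congr (measurable _); apply/seteqP; split=> w /=.
    by rewrite in_itv /= andbT.
  by rewrite in_itv /= andbT.
rewrite (_ : [set _ | _] = E b `|`
    \bigcup_(k : rat) (if a <= ratr k <= b then E (ratr k) else set0)); last first.
  apply/seteqP; split=> w /=.
    move=> /ereal_sup_gt[_ [s /= + <-]]; rewrite in_itv /= lte_fin => /andP[as_ sb] es.
    move: sb; rewrite le_eqVlt => /orP[/eqP sb|sb]; first by left; rewrite /E /= -sb.
    right.
    have c : (fun v => `|Y v w - X v w|) v @[v --> s^'+] --> `|Y s w - X s w|.
      by apply: cvg_norm; apply: cvgB; [exact: rY|exact: rX].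
    have : \forall v \near s^'+, [/\ s < v, v < b & e < `|Y v w - X v w|].
      near=> v; split; near: v; [exact: nbhs_right_gt|exact: nbhs_right_lt|].
      exact: (cvgr_gt _ c).
    move=> [dl /= dl0 hdl].
    have [k] := @rat_in_itvoo R s (s + dl) ltac:(by rewrite ltrDl).
    rewrite in_itv /= => /andP[sk kd].
    have [_ kb ek] : [/\ s < ratr k, ratr k < b & e < `|Y (ratr k) w - X (ratr k) w|].
      by apply: hdl => //=; rewrite ltr_norml; lra.
    exists k => //=; rewrite ifT //; lra.
  have up s : a <= s <= b -> E s w -> (e%:E < sup_abs_diff Y X a b w)%E.
    move=> sab es; apply: (@lt_le_trans _ _ (`|Y s w - X s w|)%:E).
      by rewrite lte_fin.
    by apply: ereal_sup_ubound; exists s => //=; rewrite in_itv.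
  move=> [Eb|[k _]]; first by apply: (up b) => //; rewrite ab lexx.
  by case: ifP => // kab; exact: up.
apply: measurableU; first by apply: mE; rewrite ab lexx.
apply: bigcupT_measurable_rat => k; case: ifP => // kab; exact: mE.
Unshelve. all: by end_near. Qed.

End ConvergenceInProbability.

(** * Second moment of a sum of two independent centered variables *)

Section IndependentSum.
Context {d : measure_display} {T : measurableType d} {R : realType}.
Variable P : probability T R.

(* The second moment may be infinite: then so is the right-hand side, because
   [y ^+ 2 <= 2 (x + y) ^+ 2 + 2 x ^+ 2]. *)
Lemma integral_sqrD_ge (m : probability (R) R) (x : R) :
  m.-integrable setT (EFin : R -> \bar R) ->
  (\int[m]_y y%:E = 0)%E ->
  ((x ^+ 2)%:E + \int[m]_y (y ^+ 2)%:E <= \int[m]_y ((x + y) ^+ 2)%:E)%E.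
Proof.
move=> im m0.
have icst (k : R) : (\int[m]_(_ in setT) k%:E = k%:E)%E.
  by rewrite integral_cst //= probability_setT mule1.
have msq (f : R -> R) : measurable_fun setT f ->
    measurable_fun setT (fun y => ((f y) ^+ 2)%:E).
  by move=> mf; apply/measurable_EFinP; apply: measurable_funX.
have mid : measurable_fun setT (fun y : R => (y : R)).
  exact: measurable_id.
have mxD : measurable_fun setT (fun y : R => x + y : R).
  exact: measurable_funD.
have ge0 (f : R -> R) : (0 <= \int[m]_y ((f y) ^+ 2)%:E)%E.
  by apply: integral_ge0 => y _; rewrite lee_fin sqr_ge0.
have [vy|vfin] := eqVneq (\int[m]_y (y ^+ 2)%:E)%E +oo%E.
  have : (\int[m]_y (y ^+ 2)%:E <= \int[m]_y
     (2%:E * ((x + y) ^+ 2)%:E + (2 * x ^+ 2)%:E))%E.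
    apply: ge0_le_integral => //.
    - by move=> y _; rewrite lee_fin sqr_ge0.
    - exact: msq.
    - by apply: emeasurable_funD => //; apply: measurable_funeM; exact: msq.
    - move=> y _; rewrite -EFinM -EFinD lee_fin.
      have := sqr_ge0 (y + 2 * x); rewrite !expr2; nra.
  rewrite ge0_integralD //; last 3 first.
  - by move=> y _; rewrite -EFinM lee_fin mulr_ge0 ?sqr_ge0.
  - by apply: measurable_funeM; exact: msq.
  - by move=> y _; rewrite lee_fin mulr_ge0 ?sqr_ge0.
  rewrite ge0_integralZl //; last 2 first.
  - exact: msq.
  - by move=> y _; rewrite lee_fin sqr_ge0.
  rewrite icst vy leye_eq => /eqP.
  move: (ge0 (fun y => x + y)).
  case: (\int[m]_y _)%E => //= s _; by rewrite leey.
have sfin : (\int[m]_y (y ^+ 2)%:E)%E \is a fin_num.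
  by rewrite ge0_fin_numE ?(ge0 id) // ltey.
have isq : m.-integrable setT (fun y : R => (y ^+ 2)%:E).
  apply/integrableP; split; first exact: msq.
  rewrite (@eq_integral _ _ _ _ _ (fun y : R => (y ^+ 2)%:E)) ?ltey //.
  by move=> y _; rewrite gee0_abs // lee_fin sqr_ge0.
have ix : m.-integrable setT (fun y : R => ((2 * x)%:E * y%:E)%E).
  exact: integrableZl.
have ic : m.-integrable setT (cst (x ^+ 2)%:E : R -> \bar R).
  apply/integrableP; split=> //.
  by rewrite icst ltry.
rewrite [leRHS](@eq_integral _ _ _ m setT
   (fun y : R => (((x ^+ 2)%:E + (2 * x)%:E * y%:E) + (y ^+ 2)%:E)%E)).
  rewrite integralD //; last exact: integrableD.
  by rewrite integralD // integralZl // m0 mule0 adde0 icst.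
by move=> y _; rewrite -EFinM -!EFinD; congr EFin; ring.
Qed.

(** Independence and equality of the laws make the joint law the product of [m] with itself, and
    Tonelli reduces the claim to a fixed first coordinate. As an inequality it also covers infinite
    second moments. *)
Lemma independent_centered_sq_le (X Y : T -> R) :
  measurable_fun setT X -> measurable_fun setT Y ->
  (forall A B, measurable A -> measurable B ->
     P (X @^-1` A `&` Y @^-1` B) = (P (X @^-1` A) * P (Y @^-1` B))%E) ->
  (forall B, measurable B -> P (X @^-1` B) = P (Y @^-1` B)) ->
  P.-integrable setT (EFin \o X) -> (\int[P]_w (X w)%:E = 0)%E ->
  (\int[P]_w ((X w) ^+ 2)%:E + \int[P]_w ((X w) ^+ 2)%:E <=
   \int[P]_w ((X w + Y w) ^+ 2)%:E)%E.
Proof.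
move=> mX mY indep same iX X0.
pose X' : {mfun T >-> R} := HB.pack X (isMeasurableFun.Build _ _ _ _ X mX).
pose XY w : R * R := (X w, Y w).
have mXY : measurable_fun setT XY by exact: measurable_fun_pair.
pose XY' : {mfun T >-> (R * R)%type} :=
  HB.pack XY (isMeasurableFun.Build _ _ _ _ XY mXY).
pose m : probability (R) R := distribution P X'.
pose n : probability (R * R)%type R :=
  distribution P XY'.
have prodE A : measurable A -> (m \x m)%E A = n A.
  apply: product_measure_unique => A1 B1 mA1 mB1.
  by rewrite /n /m /= /distribution /pushforward /= (same B1) // -indep.
have msq : measurable_fun setT (fun y : R => (y ^+ 2)%:E).
  by apply/measurable_EFinP; apply: measurable_funX; exact: measurable_id.
have lawX : (\int[m]_y (y ^+ 2)%:E = \int[P]_w ((X w) ^+ 2)%:E)%E.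
  by rewrite ge0_integral_distribution // => y; rewrite lee_fin sqr_ge0.
have im : m.-integrable setT (EFin : R -> \bar R).
  exact: integrable_pushforward.
have m0 : (\int[m]_y y%:E = 0)%E.
  rewrite (@integral_distribution _ _ _ _ _ P X' EFin) //.
pose f (z : R * R) : \bar R := ((z.1 + z.2) ^+ 2)%:E.
have mf : measurable_fun setT f.
  apply/measurable_EFinP; apply: measurable_funX; apply: measurable_funD.
    exact: measurable_fst.
  exact: measurable_snd.
have f0 z : (0 <= f z)%E by rewrite lee_fin sqr_ge0.
have -> : (\int[P]_w ((X w + Y w) ^+ 2)%:E = \int[n]_z f z)%E.
  by rewrite ge0_integral_distribution.
rewrite (@eq_measure_integral _ _ _ _ (m \x m)%E); last by move=> A mA _; apply/esym/prodE.
rewrite fubini_tonelli1 // -lawX.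
have -> : (\int[m]_y (y ^+ 2)%:E + \int[m]_y (y ^+ 2)%:E =
  \int[m]_x ((x ^+ 2)%:E + \int[m]_y (y ^+ 2)%:E))%E.
  rewrite ge0_integralD //.
  - by rewrite integral_cst //= probability_setT mule1.
  - by move=> x _; rewrite lee_fin sqr_ge0.
  - by move=> x _; apply: integral_ge0 => y _; rewrite lee_fin sqr_ge0.
apply: ge0_le_integral => //.
- by move=> x _; apply: adde_ge0; [|apply: integral_ge0 => y _]; rewrite lee_fin sqr_ge0.
- exact: emeasurable_funD.
- exact: measurable_fun_fubini_tonelli_F.
- by move=> x _; exact: integral_sqrD_ge.
Qed.

End IndependentSum.

(** * Dyadic sums of squared increments dominate the squared jumps *)

Section DyadicQuadraticVariation.
Context {R : realType}.

Lemma sum_uniq_le (F : nat -> R) n (t : seq nat) : (forall i, 0 <= F i) ->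
  uniq t -> (forall i, i \in t -> (i < n)%N) ->
  \sum_(i <- t) F i <= \sum_(i < n) F i.
Proof.
move=> F0 ut tn; rewrite -(big_mkord xpredT F) [leRHS](bigID (mem t)) /=.
rewrite -[leLHS]addr0; apply: lerD; last exact: sumr_ge0.
rewrite -[leRHS]big_filter le_eqVlt; apply/orP; left; apply/eqP; apply: perm_big.
apply: uniq_perm => //; first by rewrite filter_uniq // iota_uniq.
move=> i; rewrite mem_filter mem_index_iota /=.
by case: (boolP (i \in t)) => //= it; rewrite tn.
Qed.

Lemma limn_einf_ge (u : nat -> \bar R) c :
  (\forall n \near \oo, (c <= u n)%E) -> (c <= limn_einf u)%E.
Proof.
move=> [N _ Nu]; rewrite limn_einf_lim (cvg_lim _ (@cvg_einfs_sup R u)) //.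
apply: (@le_trans _ _ (einfs u N)); last by apply: ereal_sup_ubound; exists N.
by apply: le_ereal_inf_tmp => _ [n /= Nn <-]; exact: Nu.
Qed.

Lemma limn_einf_le (u : nat -> \bar R) c :
  (forall n, (u n <= c)%E) -> (limn_einf u <= c)%E.
Proof.
move=> uc; rewrite limn_einf_lim (cvg_lim _ (@cvg_einfs_sup R u)) //.
apply: ge_ereal_sup => _ [n _ <-]; apply: le_trans (uc n).
by apply: ereal_inf_lbound; exists n => /=.
Qed.

Definition dyadic_sum (l : R -> R) (a h : R) (k : nat) : R :=
  \sum_(i < 2 ^ k) (l (a + i.+1%:R * (h / 2 ^+ k)) - l (a + i%:R * (h / 2 ^+ k))) ^+ 2.

(** The half-open form assigns a jump at a grid point to the mesh interval that ends there, so that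
    the increment contains it. *)
Lemma nat_ceil_lt (y : R) (N : nat) : 0 < y <= N%:R ->
  exists i, (i < N)%N /\ i%:R < y <= i.+1%:R.
Proof.
elim: N => [|N IH] yN; first by exfalso; move: yN; rewrite /=; lra.
have [yN'|Ny] := leP y N%:R.
  have [|i [iN hi]] := IH; first by rewrite yN'; lra.
  by exists i; split=> //; exact: leqW.
by exists N; split=> //; rewrite Ny; lra.
Qed.

Lemma dyadic_mesh_cvg (h e : R) : 0 < h -> 0 < e ->
  \forall k \near \oo, h / 2 ^+ k < e.
Proof.
move=> h0 e0; have /cvgrPdist_lt/(_ e e0) : (fun k => h / 2 ^+ k) @ \oo --> (0 : R).
  rewrite -(mulr0 h); apply: cvgM; first exact: cvg_cst.
  under eq_fun do rewrite -exprVn.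
  by apply: cvg_expr; rewrite ger0_norm ?invr_ge0 // invf_lt1 // ltr1n.
apply: filterS => k; rewrite sub0r normrN gtr0_norm //.
by rewrite divr_gt0 // exprn_gt0.
Qed.

(* Once the mesh separates the points of a finite set, each of its points lies in
   its own mesh interval, on which the increment of [l] tends to the jump. *)
Lemma esum_jump_le_dyadic (r a h : R) (l : R -> R) : - r <= a -> 0 < h ->
  cadlag_on (- r) +oo%E l ->
  (\esum_(u in `]a, (a + h)%R]) ((jump l u) ^+ 2)%:E <=
   limn_einf (fun k => (dyadic_sum l a h k)%:E))%E.
Proof.
move=> ra h0 [rl ll].
pose dl k : R := h / 2 ^+ k.
have dl0 k : 0 < dl k by rewrite divr_gt0 // exprn_gt0.
have [i hi] : exists i : nat -> R -> nat, forall k x, a < x <= a + h ->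
    (i k x < 2 ^ k)%N /\ a + (i k x)%:R * dl k < x <= a + (i k x).+1%:R * dl k.
  (* The constraint on the point stands inside the existential, so that choice applies to all pairs;
     elsewhere the index is arbitrary. *)
  have H (kx : nat * R) : exists i, a < kx.2 <= a + h ->
    (i < 2 ^ kx.1)%N /\ a + i%:R * dl kx.1 < kx.2 <= a + i.+1%:R * dl kx.1.
    case: kx => k x /=; have [xh|xh] := boolP (a < x <= a + h); last by exists 0%N.
    have [|i [ik ix]] := @nat_ceil_lt ((x - a) / dl k) (2 ^ k).
      rewrite divr_gt0 //; last by lra.
      rewrite ler_pdivrMr // natrX /dl mulrCA mulfV ?mulr1; last by rewrite expf_neq0.
      by rewrite /=; lra.
    exists i => _; split=> //; move: ix.
    by rewrite ltr_pdivlMr // ler_pdivrMr //; lra.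
  have [f hf] := choice H; exists (fun k x => f (k, x)) => k x; exact: (hf (k, x)).
pose D k x := l (a + (i k x).+1%:R * dl k) - l (a + (i k x)%:R * dl k).
have mesh k x : a + (i k x).+1%:R * dl k = a + (i k x)%:R * dl k + dl k.
  by rewrite -natr1 mulrDl mul1r addrA.
have cD x : a < x <= a + h -> D k x @[k --> \oo] --> jump l x.
  move=> xh; apply/cvgrPdist_le => e e0.
  have e20 : 0 < e / 2 by rewrite divr_gt0.
  have rx : - r < x by lra.
  have /cvgrPdist_le/(_ _ e20)[d1 /= d10 h1] := rl x (ltW rx) (ltry _).
  have cl : l y @[y --> x^'-] --> leftlim l x by exact: (ll x rx (leey _)).
  have /cvgrPdist_le/(_ _ e20)[d2 /= d20 h2] := cl.
  near=> k.
  have k1 : dl k < d1 by near: k; exact: dyadic_mesh_cvg.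
  have k2 : dl k < d2 by near: k; exact: dyadic_mesh_cvg.
  (* The left node lies strictly below [x], but the right node may be [x] itself, which the filter
     [x^'+] excludes. *)
  have [_ hix] := hi k x xh; have hm := mesh k x.
  have b1 : `|l x - l (a + (i k x).+1%:R * dl k)| <= e / 2.
    have [xE|ne] := eqVneq x (a + (i k x).+1%:R * dl k).
      by rewrite -xE subrr normr0 ltW.
    apply: h1 => /=; last by rewrite lt_neqAle ne; case/andP: hix.
    rewrite ltr_norml; lra.
  have b2 : `|leftlim l x - l (a + (i k x)%:R * dl k)| <= e / 2.
    apply: h2 => /=; last by case/andP: hix.
    rewrite ltr_norml; lra.
  rewrite /jump /D (_ : l x - leftlim l x - _ =
    (l x - l (a + (i k x).+1%:R * dl k)) - (leftlim l x - l (a + (i k x)%:R * dl k))).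
    by have := ler_normB (l x - l (a + (i k x).+1%:R * dl k))
      (leftlim l x - l (a + (i k x)%:R * dl k)); lra.
  by ring.
apply: ge_ereal_sup => _ [X [finX XA] <-].
rewrite fsbig_finite //= sumEFin; set s := enum_fset (fset_set X).
have us : uniq s by exact: fset_uniq.
have sA x : x \in s -> a < x <= a + h.
  by rewrite /s in_fset_set // => /set_mem /XA /=; rewrite in_itv.
have csum : (\sum_(x <- s) (D k x) ^+ 2) @[k --> \oo] --> \sum_(x <- s) (jump l x) ^+ 2.
  rewrite big_seq; under eq_fun do rewrite big_seq.
  apply: cvg_big => [|x xs]; first exact: add_continuous.
  exact: (cvgM (cD x (sA x xs)) (cD x (sA x xs))).
have inj : \forall k \near \oo, forall x, x \in s -> forall y, y \in s ->
    i k x = i k y -> x = y.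
  apply: near_forall_seq => x xs; apply: near_forall_seq => y ys.
  have [->|xy] := eqVneq x y; first by near=> k.
  near=> k => ixy; exfalso.
  have : dl k < `|x - y| by near: k; apply: dyadic_mesh_cvg => //; rewrite normr_gt0 subr_eq0.
  have [_ hx] := hi k x (sA x xs); have [_ hy] := hi k y (sA y ys).
  have hm := mesh k x; rewrite -ixy in hy.
  by apply/negP; rewrite -leNgt ler_norml; lra.
apply/lee_addgt0Pr => e e0; rewrite -leeBlDr //; apply: limn_einf_ge.
have /cvgrPdist_le/(_ e e0) cs := csum.
near=> k.
rewrite -EFinB lee_fin lerBlDr.
have b1 : \sum_(x <- s) (D k x) ^+ 2 <= dyadic_sum l a h k.
  have -> : \sum_(x <- s) (D k x) ^+ 2 = \sum_(j <- map (i k) s)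
     (l (a + j.+1%:R * dl k) - l (a + j%:R * dl k)) ^+ 2 by rewrite big_map.
  rewrite /dyadic_sum.
  apply: (sum_uniq_le (F := fun j => (l (a + j.+1%:R * dl k) - l (a + j%:R * dl k)) ^+ 2)).
  - by move=> j; exact: sqr_ge0.
  - rewrite map_inj_in_uniq // => x y xs ys; move: x xs y ys.
    by near: k; exact: inj.
  - by move=> _ /mapP[x xs ->]; case: (hi k x (sA x xs)).
have b2 : `|\sum_(x <- s) (jump l x) ^+ 2 - \sum_(x <- s) (D k x) ^+ 2| <= e.
  by near: k; exact: cs.
by move: b2; rewrite ler_norml; lra.
Unshelve. all: by end_near. Qed.

End DyadicQuadraticVariation.

(** * Almost sure finiteness of the squared jumps of the Lévy process *)

Section LevyQuadraticVariation.
Context {d : measure_display} {T : measurableType d} {R : realType}.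
Variable P : probability T R.

Lemma ge0_integral_same_law (X Y : T -> R) (f : R -> \bar R) :
  measurable_fun setT X -> measurable_fun setT Y -> measurable_fun setT f ->
  (forall y, (0 <= f y)%E) ->
  (forall B, measurable B -> P (X @^-1` B) = P (Y @^-1` B)) ->
  (\int[P]_w f (X w) = \int[P]_w f (Y w))%E.
Proof.
move=> mX mY mf f0 same.
pose X' : {mfun T >-> R} := HB.pack X (isMeasurableFun.Build _ _ _ _ X mX).
pose Y' : {mfun T >-> R} := HB.pack Y (isMeasurableFun.Build _ _ _ _ Y mY).
rewrite -(@ge0_integral_distribution _ _ _ _ _ P X' f) //.
rewrite -(@ge0_integral_distribution _ _ _ _ _ P Y' f) //.
by apply: eq_measure_integral => A mA _; exact: same.
Qed.

(** [G] is a bare family of sets. Measurability of the difference is proved for the sigma-algebra it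
    generates, which is [G] itself. *)
Lemma G_measurableB (G : set (set T)) (f g : T -> R) : sigma_algebra setT G ->
  G_measurable G f -> G_measurable G g -> G_measurable G (fun w => f w - g w).
Proof.
move=> sG Gf Gg.
have meas (h : T -> R) : G_measurable G h ->
    measurable_fun [set: g_sigma_algebraType G] (h : g_sigma_algebraType G -> R).
  by move=> Gh _ B mB; rewrite setTI; apply: sub_sigma_algebra; apply/set_mem/Gh.
have mfg : measurable_fun [set: g_sigma_algebraType G]
    ((fun w => f w - g w) : g_sigma_algebraType G -> R).
  by apply: measurable_funB; exact: meas.
move=> B mB; have := mfg measurableT B mB; rewrite setTI => h.
by apply/mem_set; move: h; rewrite /measurable /= sigma_algebra_id.
Qed.

Variables (r : R) (F : R -> set (set T)) (L : R -> T -> R).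
Hypotheses (r0 : 0 <= r) (hF : usual_filtration P r F).
Hypothesis hL : Levy_no_brownian P r F L.

Lemma adapted_measurable (X : R -> T -> R) t : adapted r F X -> - r <= t ->
  measurable_fun setT (X t).
Proof.
move=> aX rt _ B mB; rewrite setTI.
by case: hF => _ [Fm _]; apply: (Fm t rt); apply/set_mem/aX.
Qed.

Let incr_measurable s t : - r <= s -> - r <= t -> measurable_fun setT (incr L s t).
Proof.
case: hL => aL _ rs rt.
by apply: measurable_funB; exact: adapted_measurable.
Qed.

Definition incr_sq (s t : R) : \bar R := (\int[P]_w ((incr L s t w) ^+ 2)%:E)%E.

Let sq_measurable : measurable_fun setT (fun y : R => (y ^+ 2)%:E).
Proof. by apply/measurable_EFinP; apply: measurable_funX; exact: measurable_id. Qed.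

Lemma incr_sq_stationary s t s' t' : - r <= s <= t -> - r <= s' <= t' ->
  t - s = t' - s' -> incr_sq s t = incr_sq s' t'.
Proof.
move=> st st' ts; rewrite /incr_sq.
apply: (ge0_integral_same_law (f := fun y => (y ^+ 2)%:E)) => //.
- by apply: incr_measurable; lra.
- by apply: incr_measurable; lra.
- by move=> y; rewrite lee_fin sqr_ge0.
- case: hL => _ [_ [_ [_ [stat _]]]] B mB; apply: stat => //; lra.
Qed.

(** The increment over the double length splits at [-r + a]. The first half is measurable at that
    time, hence independent of the second; both have the same law by stationarity and are
    centered. *)
Lemma incr_sq_half a : 0 <= a ->
  (incr_sq (- r) (- r + a) + incr_sq (- r) (- r + a) <= incr_sq (- r) (- r + (a + a)))%E.
Proof.
move=> a0; case: hL => aL [_ [_ [indep [stat [cent _]]]]].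
have r1 : - r <= - r + a by lra.
have r2 : - r + a <= - r + (a + a) by lra.
have [Fs [_ [Fmono _]]] := hF.
rewrite [leRHS](_ : _ = \int[P]_w ((incr L (- r) (- r + a) w +
    incr L (- r + a) (- r + (a + a)) w) ^+ 2)%:E)%E; last first.
  by apply: eq_integral => w _; congr (_ ^+ 2)%:E; rewrite /incr; ring.
have [i0 c0] := cent (- r) (lexx _).
have [ia ca] := cent (- r + a) r1.
apply: independent_centered_sq_le.
- exact: incr_measurable.
- by apply: incr_measurable; lra.
- move=> A B mA mB; apply: indep => //.
  apply/set_mem; apply: (G_measurableB (Fs _ r1) _ _ mA).
    exact: aL.
  by move=> C mC; apply/mem_set; apply: (Fmono (- r)) => //; apply/set_mem; exact: aL.
- by move=> B mB; apply: stat => //; lra.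
- exact: (integrableB _ ia i0).
- rewrite (_ : (\int[P]_w _)%E = (\int[P]_w ((L (- r + a) w)%:E - (L (- r) w)%:E))%E).
    by rewrite integralB // ca c0 sube0.
  by apply: eq_integral => w _; rewrite /incr EFinB.
Qed.

Lemma incr_sq_dyadic h k : 0 <= h ->
  ((2 ^+ k)%:E * incr_sq (- r) (- r + h / 2 ^+ k) <= incr_sq (- r) (- r + h))%E.
Proof.
move=> h0; elim: k => [|k IH]; first by rewrite expr0 divr1 mul1e.
apply: le_trans IH; rewrite exprSr EFinM -muleA.
apply: lee_wpmul2l; first by rewrite lee_fin exprn_ge0.
have a0 : 0 <= h / (2 ^+ k * 2) by rewrite divr_ge0 // mulr_ge0 // exprn_ge0.
have -> : h / 2 ^+ k = h / (2 ^+ k * 2) + h / (2 ^+ k * 2).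
  by field; rewrite expf_neq0.
by rewrite mule_natl mule2n; exact: incr_sq_half.
Qed.

(** [L] vanishes at [-r], so the increment is [L 1], and [x^2 <= 1 + x^4] reduces to the fourth
    moment. *)
Lemma incr_sq_lty : (incr_sq (- r) 1 < +oo)%E.
Proof.
have r_ge0 := r0; case: hL => aL [_ [L0 [_ [_ [_ [m4 _]]]]]].
have mL : measurable_fun setT (L 1) by apply: adapted_measurable aL _; lra.
have m4' : measurable_fun setT (fun w => ((L 1 w) ^+ 4)%:E).
  by apply/measurable_EFinP; exact: measurable_funX.
apply: (@le_lt_trans _ _ (\int[P]_w (1%:E + ((L 1 w) ^+ 4)%:E))%E).
  apply: ge0_le_integral => //.
  - by move=> w _; rewrite lee_fin sqr_ge0.
  - by apply/measurable_EFinP; apply: measurable_funX; apply: incr_measurable; lra.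
  - exact: emeasurable_funD.
  - move=> w _; rewrite -EFinD lee_fin /incr L0 subr0.
    rewrite (_ : L 1 w ^+ 4 = (L 1 w ^+ 2) * (L 1 w ^+ 2)); last by ring.
    by have := sqr_ge0 (L 1 w ^+ 2 - 1); rewrite expr2; nra.
rewrite ge0_integralD //; last first.
- by move=> w _; rewrite lee_fin (_ : L 1 w ^+ 4 = (L 1 w ^+ 2) ^+ 2) ?sqr_ge0 //; ring.
by rewrite integral_cst //= probability_setT mule1 lte_add_pinfty // ltry.
Qed.

(** The length of [[-r, 1]], the interval whose increment has a second moment known to be finite. *)
Let h : R := 1 + r.
Let h0 : 0 < h. Proof. by rewrite /h; move: r0 => ?; lra. Qed.

(** By stationarity all terms have the mean of the first mesh increment after [-r], so the bound
    depends neither on [k] nor on [a]. *)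
Lemma integral_dyadic_sum_le a k : - r <= a ->
  (\int[P]_w (dyadic_sum (fun u => L u w) a h k)%:E <= incr_sq (- r) 1)%E.
Proof.
move=> ra.
have d0 : 0 < h / 2 ^+ k by rewrite divr_gt0 // exprn_gt0.
pose node (i : nat) : R := a + i%:R * (h / 2 ^+ k).
have rn i : - r <= node i by rewrite /node (le_trans ra) // lerDl mulr_ge0 // ltW.
have -> : (\int[P]_w (dyadic_sum (fun u => L u w) a h k)%:E =
    \int[P]_w \sum_(i < 2 ^ k) ((incr L (node i) (node i.+1) w) ^+ 2)%:E)%E.
  by apply: eq_integral => w _; rewrite /dyadic_sum sumEFin.
rewrite ge0_integral_sum //; last 2 first.
- by move=> i; apply/measurable_EFinP; apply: measurable_funX; exact: incr_measurable.
- by move=> i w _; rewrite lee_fin sqr_ge0.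
rewrite (eq_bigr (fun=> incr_sq (- r) (- r + h / 2 ^+ k))); last first.
  move=> i _; apply: incr_sq_stationary.
  - by rewrite rn /= /node -natr1; lra.
  - by rewrite lexx /=; lra.
  - by rewrite /node -natr1; ring.
have iterE (v : \bar R) n : iter n (+%R v) 0%R = (n%:R%:E * v)%E.
  elim: n => [|n IH]; first by rewrite mul0e.
  by rewrite iterS IH -natr1 EFinD ge0_muleDl ?lee_fin // mul1e addeC.
rewrite big_const_ord iterE natrX.
apply: le_trans (incr_sq_dyadic k (ltW h0)) _.
by rewrite /h addrCA addNr addr0.
Qed.

(** Only the lower limit of the dyadic sums, which is measurable, is integrated; the sum over
    uncountably many times is compared with it path by path. *)
Lemma ae_esum_jump_lty a : - r <= a -> \forall w \ae P,
  (\esum_(u in `]a, (a + h)%R]) ((jump (fun t => L t w) u) ^+ 2)%:E < +oo)%E.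
Proof.
move=> ra; case: (hL) => aL [cL _].
pose Q k w : \bar R := (dyadic_sum (fun u => L u w) a h k)%:E.
have mQ k : measurable_fun setT (Q k).
  apply/measurable_EFinP; apply: measurable_sum => i; apply: measurable_funX.
  have rn j : - r <= a + j%:R * (h / 2 ^+ k).
    by rewrite (le_trans ra) // lerDl mulr_ge0 // divr_ge0 ?ltW // exprn_gt0.
  by apply: measurable_funB; apply: adapted_measurable aL (rn _).
have Q0 k w : (0 <= Q k w)%E.
  by rewrite lee_fin; apply: sumr_ge0 => i _; exact: sqr_ge0.
have int_lt : (\int[P]_w limn_einf (Q^~ w) < +oo)%E.
  apply: le_lt_trans incr_sq_lty.
  apply: le_trans (fatou P measurableT mQ (fun n x _ => Q0 n x)) _.
  by apply: limn_einf_le => k; exact: integral_dyadic_sum_le.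
have lim0 w : (0 <= limn_einf (Q^~ w))%E by apply: limn_einf_ge; near=> k.
have iQ : P.-integrable setT (fun w => limn_einf (Q^~ w)).
  apply/integrableP; split.
    rewrite /limn_einf; apply: measurableT_comp => //.
    apply: measurable_fun_limn_esup => k; apply: measurableT_comp => //.
  rewrite (eq_integral (fun w => limn_einf (Q^~ w))) // => w _.
  by rewrite gee0_abs.
have := integrable_ae measurableT iQ; apply: filterS => w /(_ I).
rewrite ge0_fin_numE // => lw.
exact: le_lt_trans (esum_jump_le_dyadic ra h0 (cL w)) lw.
Unshelve. all: by end_near. Qed.

(** Countably many windows of length [h] cover the times after [-r], so one null set serves all
    [b]. *)
Lemma ae_finite_quadratic_variation :
  \forall w \ae P, finite_quadratic_variation r (fun t => L t w).
Proof.
pose s (n : nat) : R := - r + n%:R * h.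
have rs n : - r <= s n by rewrite /s lerDl mulr_ge0 // ltW.
have /ae_foralln := fun n => ae_esum_jump_lty (rs n).
apply: filterS => w sw b.
have sq0 u : 0 <= (jump (fun t => L t w) u) ^+ 2 by exact: sqr_ge0.
have fin n : (\esum_(u in `](- r)%R, s n]) ((jump (fun t => L t w) u) ^+ 2)%:E < +oo)%E.
  elim: n => [|n IH].
    by rewrite /s mul0r addr0 set_itvoc0 esum_set0 ltry.
  rewrite (esumID `](- r)%R, s n]%classic) //; last by move=> *; rewrite lee_fin.
  apply: lte_add_pinfty.
    apply: le_lt_trans IH; apply: subset_esum => // u /=; by case.
  apply: le_lt_trans (sw n); apply: subset_esum => // u /=.
  rewrite !in_itv /= => -[/andP[u1 u2] /negP].
  rewrite u1 /= -ltNge => ->; rewrite (le_trans u2) //.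
  by rewrite /s -natr1 mulrDl mul1r addrA.
have [n bn] : exists n, b <= s n.
  exists (Num.truncn ((b + r) / h)).+1.
  rewrite /s -lerBlDl opprK -ler_pdivrMr //; apply/ltW.
  exact: truncnS_gt.
apply: le_lt_trans (fin n); apply: subset_esum => // u /=; rewrite !in_itv /=.
by move=> /andP[-> ub] /=; exact: le_trans bn.
Qed.

End LevyQuadraticVariation.

Unset Implicit Arguments.

(** * Convergence of the approximating solutions *)

Theorem theorem4p13
  (d : measure_display) (T : measurableType d) (R : realType)
  (P : probability T R)
  (p q : R) (hp : 0 <= p) (hq : 0 <= q)
  (F : R -> set (set T)) (hF : usual_filtration P (Num.max p q) F)
  (L : R -> T -> R) (hL : Levy_no_brownian P (Num.max p q) F L)
  (eta c_mu c_nu : R) (heta : 0 < eta) (hcmu : 0 < c_mu) (hcnu : 0 < c_nu)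
  (f_mu f_nu : R -> R)
  (hfmu : (forall x, 0 <= f_mu x) /\ continuous f_mu /\
          (forall x, ~ (- p <= x <= 0) -> f_mu x = 0))
  (hfnu : (forall x, 0 <= f_nu x) /\ continuous f_nu /\
          (forall x, ~ (- q <= x <= 0) -> f_nu x = 0))
  (Phi : R -> T -> R)
  (hPhi_cadlag : forall w, cadlag_on (- Num.max p q) 0%:E (fun t => Phi t w))
  (hPhi_adapted : forall t, - Num.max p q <= t <= 0 ->
     exists g : T -> R, G_measurable (natural_sigma (Num.max p q) L t) g /\
       (\forall w \ae P, Phi t w = g w))
  (hPhi_sq : sup_sq_integrable P Phi (- Num.max p q) 0)
  (X : R -> T -> R)
  (hX : is_solution P (Num.max p q) eta c_mu c_nu p q f_mu f_nu 0 F L Phi X)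
  (Xn : nat -> R -> T -> R)
  (hXn : forall n : nat, (0 < n)%N ->
     is_solution P (Num.max p q) eta c_mu c_nu p q f_mu f_nu (n%:R)^-1 F L Phi
       (Xn n)) :
  forall t : R, 0 < t -> forall eps : R, 0 < eps ->
    P [set w | (eps%:E < sup_abs_diff (Xn n) X (- Num.max p q) t w)%E]
      @[n --> \oo] --> 0%E.
Proof.
move=> t t0 eps eps0.
set r := Num.max p q in hF hL hX hXn *.
have pr : 0 <= p <= r by rewrite hp /r le_max lexx.
have qr : 0 <= q <= r by rewrite hq /r le_max lexx orbT.
have r0 : 0 <= r by lra.
have [_ [cfm fm0]] := hfmu; have [_ [cfn fn0]] := hfnu.
have [aX [cX [_ [XPhi [_ eqX]]]]] := hX.
have hXn' n := hXn n.+1 (ltn0Sn n).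
have aXn n := (hXn' n).1; have cXn n := (hXn' n).2.1.
(* The equation for [Xn n] is given for [0 < n] only, so the sequence is shifted by one. *)
rewrite -(cvg_shiftS _).
apply: (@ae_eventually_notin_cvg _ _ _ P
  (fun n => [set w | (eps%:E < sup_abs_diff (Xn n.+1) X (- r) t w)%E])).
  move=> n; apply: measurable_sup_abs_diff; first by lra.
  - by move=> s /andP[rs _]; exact: (adapted_measurable hF aX).
  - by move=> s /andP[rs _]; exact: (adapted_measurable hF (aXn n)).
  - by move=> w s rs; apply: (cX w).1 => //; rewrite ltry.
  - by move=> w s rs; apply: (cXn n w).1 => //; rewrite ltry.
(* The exceptional set of each equation depends on [n]; a countable union removes this
   dependence. *)
have eqXn : \forall w \ae P, forall n s, 0 <= s -> Xn n.+1 s w = Xn n.+1 0 w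
    + (\int[lebesgue_measure]_(u in `[0, s])
        drift eta c_mu p q f_mu f_nu (n.+1%:R)^-1 (fun v => L v w)
          (fun v => Xn n.+1 v w) u)
    + c_nu * dS (n.+1%:R)^-1 (fun v => L v w) 0 s
        (fun u => leftlim (fun v => Xn n.+1 v w) u).
  by apply: ae_foralln => n; case: (hXn' n) => _ [_ [_ [_ [_ ]]]].
have qv := ae_finite_quadratic_variation r0 hF hL.
(* Outside one null set the path is now fixed, and the rest is deterministic. *)
move: eqX eqXn qv; apply: filterS3 => w eqX eqXn qv.
have [Kmu [_ fmK]] := compact_support_bounded cfm fm0.
have [Knu [Knu0 fnK]] := compact_support_bounded cfn fn0.
have [M [M0 XM]] := cadlag_bounded t (cX w).
pose Wt := stability_weight p c_mu c_nu (fun u => L u w) Kmu Knu t.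
have Wt0 : 0 <= Wt by rewrite mulr_ge0 ?expR_ge0.
pose K := 2 * ((Knu * t + c_nu) * M) * Wt.
have K0 : 0 <= K by rewrite /K !mulr_ge0 // addr_ge0 ?mulr_ge0 // ltW.
(* [K] is the constant of the stability estimate with [rho] factored out and does not depend on [n];
   this choice gives [K * rho <= eps], also when [K = 0]. *)
pose rho := eps / (K + 1).
have rho0 : 0 < rho by rewrite divr_gt0 //; lra.
have [N _ HN] := small_jumps_near rho0 (qv t).
exists N => // n /= Nn; apply/negP; rewrite -leNgt.
apply: ge_ereal_sup => _ [s /= + <-]; rewrite in_itv /= => st; rewrite lee_fin.
apply: (@le_trans _ _ (2 * ((Knu * t + c_nu) * M * rho) * Wt)).
  have yx u : - r <= u <= 0 -> Xn n.+1 u w = X u w.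
    by move=> ur; rewrite XPhi //; case: (hXn' n) => _ [_ [_ [-> //]]].
  exact: (stability pr qr hcmu hcnu t0 cfm fm0 cfn fn0 qv (cX w) fmK fnK XM
    (cXn n w) (ltW rho0) (HN n.+1 (leqW Nn)) yx (eqXn n) eqX st).
rewrite (_ : _ * Wt = K * rho); last by rewrite /K; ring.
rewrite /rho mulrCA ler_piMr ?(ltW eps0) // ler_pdivrMr; lra.
Qed.
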